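(* There is a universal constant $C>0$ such that in any weighted graph on $n$ vertices there exists a ternary signaling scheme that is persuasive and has cost at most $C\, n^{3/4}\cdot(\mathsf{OPT}^{\mathsf{IR}})^{1/2}$. In addition, for any $\delta\in(0,1]$ and any weighted graph on $n$ vertices all of whose edge weights are at least $\delta$, there is a persuasive ternary signaling scheme with cost at most $C\,(n\cdot\mathsf{OPT}^{\mathsf{IR}})^{2/3}\delta^{-1/3}$. Finally, the resulting $O(n^{2/3})$ approximation ratio is tight on a family of graphs with $\delta=1/2$: there is a universal constant $c>0$ and a family of weighted graphs with arbitrarily large $n$, all of whose edge weights equal $1/2$, on which $\mathsf{OPT}^{\mathsf{IR}}=O(1)$ and every persuasive signaling scheme (with any finite signal space) has cost at least $c\,n^{2/3}$.
   Context: Setting. $V$ is a finite set of $n$ task types and $W=(W_{u,v})_{u,v\in V}$ is a symmetric matrix with entries in $[0,1]$ and $W_{v,v}=1$ for all $v$. It is represented by the weighted graph $G=(V,E,w)$ with $E=\{\{u,v\}:u\neq v,\ W_{u,v}>0\}$ and edge weights $w(\{u,v\})=W_{u,v}$ (''edge weights at least $\delta$'' means $W_{u,v}\ge\delta$ for every edge). A vector $\theta\in\mathbb{R}_{\ge0}^V$ is feasible if $W\theta\ge\mathbf 1$ coordinatewise. $\mathsf{OPT}^{\mathsf{IR}}=\min\{\|\theta\|_1:\theta\in[0,1]^V\text{ feasible}\}$. Signaling. There are $n$ agents; the type profile $t=(t_1,\dots,t_n)$ is a uniformly random bijection $[n]\to V$. A signaling scheme with finite signal space $\Sigma\subset[0,1]$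 is a map $\varphi$ assigning to each bijection $t$ a distribution $\varphi(t)$ on $\Sigma^V$; given $t$, $s=(s_v)_{v\in V}\sim\varphi(t)$ is drawn and agent $i$ privately receives $s_{t_i}$. For agent $i$, a signal $\theta\in\Sigma$ with $\Pr[s_{t_i}=\theta]>0$ and $x\ge0$, let $Q_i(x\mid\theta)=\mathbb{E}\big[x+\sum_{v'\neq t_i}W_{t_i,v'}s_{v'}\,\big|\,s_{t_i}=\theta\big]$ (over the joint law of $t,s$). The scheme is persuasive if for every agent $i$ and every such $\theta$: $Q_i(\theta\mid\theta)\ge1$ and $\theta=\min\{x\ge0:Q_i(x\mid\theta)\ge1\}$. Its cost is $\mathbb{E}[\|s\|_1]$. A ternary signaling scheme is one with $|\Sigma|=3$. *)

(* Defs.v *)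
From HB Require Import structures.
From mathcomp Require Import all_boot all_order all_algebra.
From mathcomp Require Import classical_sets reals exp.
Set Implicit Arguments. Unset Strict Implicit. Unset Printing Implicit Defensive.
Import Order.TTheory GRing.Theory Num.Theory.
Local Open Scope ring_scope.
Local Open Scope classical_set_scope.

Section Defs.
Variable R : realType.
Variable V : finType.

Definition is_weight (W : V -> V -> R) : Prop :=
  (forall u v, W u v = W v u) /\ (forall u v, 0 <= W u v <= 1) /\
  (forall v, W v v = 1).

Definition feasible (W : V -> V -> R) (th : V -> R) : Prop :=
  (forall v, 0 <= th v) /\ (forall u, 1 <= \sum_(v : V) W u v * th v).

Definition OPT_IR (W : V -> V -> R) : R :=
  inf [set x : R | exists th : V -> R,
         (forall v, 0 <= th v <= 1) /\ feasible W th /\ x = \sum_(v : V) th v].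

Definition agent := 'I_#|V|.
Definition profile := {ffun agent -> V}.
Definition bijs : {set profile} := [set t : profile | injectiveb t].

(* A signaling scheme with signal space Sigma = image of the injective
   sig : 'I_k -> [0,1]; phi t is a distribution on signal vectors
   (encoded by indices a : V -> 'I_k, the signal of v being sig (a v)). *)
Definition is_scheme (k : nat) (sig : 'I_k -> R)
    (phi : profile -> {ffun V -> 'I_k} -> R) : Prop :=
  injective sig /\ (forall j, 0 <= sig j <= 1) /\
  (forall t, t \in bijs -> (forall a, 0 <= phi t a) /\ \sum_a phi t a = 1).

Definition Ejoint (k : nat) (phi : profile -> {ffun V -> 'I_k} -> R)
    (f : profile -> {ffun V -> 'I_k} -> R) : R :=
  \sum_(t in bijs) \sum_(a : {ffun V -> 'I_k})
     (#|bijs|%:R)^-1 * phi t a * f t a.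

Definition PrSig (k : nat) (sig : 'I_k -> R) phi (i : agent) (th : R) : R :=
  Ejoint phi (fun t a => ((sig (a (t i)) == th) : nat)%:R).

Definition Qcond (W : V -> V -> R) (k : nat) (sig : 'I_k -> R) phi
    (i : agent) (x th : R) : R :=
  Ejoint phi (fun t a => ((sig (a (t i)) == th) : nat)%:R *
      (x + \sum_(v' | v' != t i) W (t i) v' * sig (a v')))
  / PrSig sig phi i th.

Definition persuasive (W : V -> V -> R) (k : nat) (sig : 'I_k -> R) phi : Prop :=
  forall (i : agent) (j : 'I_k), 0 < PrSig sig phi i (sig j) ->
    1 <= Qcond W sig phi i (sig j) (sig j) /\
    (forall x, 0 <= x -> 1 <= Qcond W sig phi i x (sig j) -> sig j <= x).

Definition cost (k : nat) (sig : 'I_k -> R) phi : R :=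
  Ejoint phi (fun t a => \sum_(v : V) sig (a v)).

End Defs.

(* Main.v *)
Require Import Defs.
From HB Require Import structures.
From mathcomp Require Import classical_sets reals exp.
From mathcomp Require Import all_boot all_order all_algebra.
From mathcomp Require Import perm zify ring lra.
Set Implicit Arguments. Unset Strict Implicit. Unset Printing Implicit Defensive.
Import Order.TTheory GRing.Theory Num.Theory.
Local Open Scope ring_scope.

(** Averaging over the uniformly random bijection, persuasiveness of a type-
    anonymous scheme says that for every signal value [z] the expected total
    slack [sum_v 1(s_v = z) (z + sum_(u != v) W_vu s_u - 1)] vanishes if
    [z > 0] and is nonnegative if [z = 0].

    Upper bounds.  Let [th] be nearly optimal, [k] its norm, [T] the target
    cost and [e = T / n].  Use signals [0], [beta ~ 1 - e], [gamma] and mix three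
    product laws: a bulk mode (weight 1) sending [beta] to [v] with probability
    [th v]; a rare mode (weight [p]) sending [beta] with probability [y v] to
    vertices that see little, so that their slack [-e] cancels the excess
    (at most [k ^ 2]) of [beta] in the bulk; and a mode (weight [q]) sending
    [gamma] with probability [1 - th v], whose excess at the receivers of [0]
    pays for the deficits [n e + k] and [p n] of the other two.  For arbitrary
    weights [y] is constant; if the weights are at least [delta], it is the
    indicator of a large independent set.  When the total weight is large, a
    constant signal is already cheap enough.

    Lower bound.  Two vertices are joined to everything, the other [m ^ 3] form
    [m ^ 2] cliques of size [m], all weights being 1/2.  A multiplier for each
    signal value, affine in the value with an extra penalty near 1, certifies by
    weak duality that every persuasive scheme costs at least [m ^ 2 / 200]. *)

(** * Persuasiveness as conditions on expected slacks *)

Section Averaging.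
Variables (R : realType) (V : finType).
Implicit Types (W : V -> V -> R) (k : nat).

Definition nbr_sum W (x : V -> R) (v : V) : R := \sum_(u | u != v) W v u * x u.

(** This is [(W s) v - 1] when [W] has unit diagonal; the own signal is kept apart because
    persuasiveness varies it alone. *)
Definition slack W (s : V -> R) (v : V) : R := s v + nbr_sum W s v - 1.

Lemma inj_bijs (t : profile V) : t \in bijs V -> injective t.
Proof. by rewrite inE => /injectiveP. Qed.

Lemma bijs_bij (t : profile V) : t \in bijs V -> bijective t.
Proof. by move=> /inj_bijs/inj_card_bij; apply; rewrite card_ord. Qed.

Lemma card_bijs_gt0 : 0 < #|bijs V|%:R :> R.
Proof.
rewrite ltr0n; apply/card_gt0P; exists [ffun i => enum_val i].
by rewrite inE; apply/injectiveP => i j; rewrite !ffunE; apply: enum_val_inj.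
Qed.

Lemma Ejoint_sum k phi (I : finType) (P : pred I)
    (f : I -> profile V -> {ffun V -> 'I_k} -> R) :
  Ejoint phi (fun t a => \sum_(i | P i) f i t a) = \sum_(i | P i) Ejoint phi (f i).
Proof.
rewrite /Ejoint [RHS]exchange_big; apply: eq_bigr => t _ /=.
by rewrite [RHS]exchange_big; apply: eq_bigr => a _ /=; rewrite mulr_sumr.
Qed.

Lemma EjointZ k phi (c : R) (f : profile V -> {ffun V -> 'I_k} -> R) :
  Ejoint phi (fun t a => c * f t a) = c * Ejoint phi f.
Proof.
rewrite /Ejoint mulr_sumr; apply: eq_bigr => t _.
by rewrite mulr_sumr; apply: eq_bigr => a _; ring.
Qed.

Lemma EjointD k phi (f g : profile V -> {ffun V -> 'I_k} -> R) :
  Ejoint phi (fun t a => f t a + g t a) = Ejoint phi f + Ejoint phi g.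
Proof.
rewrite /Ejoint -big_split; apply: eq_bigr => t _ /=.
by rewrite -big_split; apply: eq_bigr => a _ /=; ring.
Qed.

Lemma eq_Ejoint k phi (f g : profile V -> {ffun V -> 'I_k} -> R) :
  (forall t a, t \in bijs V -> f t a = g t a) -> Ejoint phi f = Ejoint phi g.
Proof.
by move=> fg; apply: eq_bigr => t tb; apply: eq_bigr => a _; rewrite fg.
Qed.

Lemma ler_Ejoint k (sig : 'I_k -> R) phi (f g : profile V -> {ffun V -> 'I_k} -> R) :
  is_scheme sig phi ->
  (forall t a, t \in bijs V -> f t a <= g t a) -> Ejoint phi f <= Ejoint phi g.
Proof.
move=> [_ [_ phiP]] fg; apply: ler_sum => t tb; apply: ler_sum => a _.
apply: ler_wpM2l; last exact: fg.
by rewrite mulr_ge0 ?invr_ge0 ?ler0n ?(proj1 (phiP t tb)).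
Qed.

Lemma Ejoint_cst k (sig : 'I_k -> R) (phi : profile V -> _ -> R) (c : R) :
  is_scheme sig phi -> Ejoint phi (fun _ _ => c) = c.
Proof.
move=> [_ [_ phiP]]; rewrite /Ejoint.
under eq_bigr => t tb do rewrite -mulr_suml -mulr_sumr (proj2 (phiP t tb)) mulr1.
rewrite sumr_const -[(_ * c) *+ _]mulr_natl mulrA mulfV ?mul1r //.
by rewrite gt_eqF // card_bijs_gt0.
Qed.

(** Left unnormalised to avoid conditioning: for a signal of positive probability it is [PrSig]
    times [Qcond - 1] at [x = sig j]. *)
Definition signal_slack W k (sig : 'I_k -> R) phi (i : agent V) (j : 'I_k) : R :=
  Ejoint phi (fun t a => ((sig (a (t i)) == sig j) : nat)%:R *
                         slack W (fun v => sig (a v)) (t i)).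

Lemma Qcond_ge1 W k (sig : 'I_k -> R) (phi : profile V -> _ -> R) i j x :
  0 < PrSig sig phi i (sig j) ->
  (1 <= Qcond W sig phi i x (sig j)) =
  (0 <= signal_slack W sig phi i j + (x - sig j) * PrSig sig phi i (sig j)).
Proof.
move=> P0; rewrite /Qcond ler_pdivlMr // mul1r -subr_ge0; congr (0 <= _).
rewrite /signal_slack /PrSig -EjointZ -EjointD.
rewrite -[X in _ - X]mul1r -mulNr -EjointZ -EjointD.
apply: eq_Ejoint => t a _; rewrite /slack /nbr_sum.
by case: eqP => [->|_] /=; ring.
Qed.

(** [Qcond] is affine and increasing in [x], so a positive signal with nonnegative slack is minimal
    exactly when the slack vanishes, while the signal 0 is always minimal. *)
Lemma persuasive_slack W k (sig : 'I_k -> R) (phi : profile V -> _ -> R) :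
  is_scheme sig phi ->
  persuasive W sig phi <->
  (forall i j, 0 < PrSig sig phi i (sig j) ->
     0 <= signal_slack W sig phi i j /\
     (0 < sig j -> signal_slack W sig phi i j = 0)).
Proof.
move=> [_ [sig01 _]]; split=> H i j P0; have [] := H i j P0.
  rewrite Qcond_ge1 // subrr mul0r addr0 => S0 Smin; split=> // sj0.
  set S := signal_slack W sig phi i j in S0 *.
  set P := PrSig _ _ _ _ in P0 Smin *.
  have xP (x : R) : 0 <= x -> 0 <= S + (x - sig j) * P -> sig j <= x.
    by move=> x0 Hx; apply: Smin; rewrite ?Qcond_ge1.
  apply/eqP; rewrite eq_le S0 andbT leNgt; apply/negP => Spos.
  have SP0 : 0 < S / P by rewrite divr_gt0.
  (* Lowering the signal by [S / P] uses up the slack exactly; the maximum keeps the candidate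
     nonnegative. *)
  have := xP (Num.max 0 (sig j - S / P)).
  have -> : (sig j <= Num.max 0 (sig j - S / P)) = false.
    by apply/negbTE; rewrite -ltNge gt_max sj0 ltrBlDr ltrDl.
  rewrite le_max lexx /= => /(_ isT) xS; suff: false by [].
  apply: xS.
  apply: (@le_trans _ _ (S + (sig j - S / P - sig j) * P)).
    by rewrite addrAC subrr sub0r mulNr divfK ?subrr ?gt_eqF.
  by rewrite lerD2l ler_wpM2r ?(ltW P0) // lerD2r le_max lexx orbT.
move=> S0 Seq; split; first by rewrite Qcond_ge1 // subrr mul0r addr0.
move=> x x0; rewrite Qcond_ge1 // => Hx.
have := sig01 j; rewrite le_eqVlt => /andP[/orP[/eqP <- //|sj0] _].
by move: Hx; rewrite Seq // add0r pmulr_lge0 // subr_ge0.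
Qed.

(** Exchanging two agents permutes the bijections, so every agent contributes the same sum; over all
    agents, each bijection runs through every type once. *)
Lemma sum_bijs (i : agent V) (F : V -> R) :
  \sum_(t in bijs V) F (t i) = #|bijs V|%:R / #|V|%:R * \sum_v F v.
Proof.
have n0 : #|V|%:R != 0 :> R.
  by rewrite pnatr_eq0 -lt0n; case: {+}i => j /(leq_trans _) ->.
have indep j : \sum_(t in bijs V) F (t j) = \sum_(t in bijs V) F (t i).
  pose h (t : profile V) : profile V := [ffun l => t (tperm i j l)].
  have hh : involutive h by move=> t; apply/ffunP=> l; rewrite !ffunE tpermK.
  rewrite (reindex_inj (inv_inj hh)); apply: eq_big => [t|t _].
    rewrite !inE; apply/injectiveP/injectiveP => tI x y.
      move=> txy; apply: (@perm_inj _ (tperm i j)); apply: tI.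
      by rewrite !ffunE !tpermK.
    by rewrite !ffunE => /tI/perm_inj.
  by rewrite ffunE tpermR.
have tot : \sum_(j : agent V) \sum_(t in bijs V) F (t j) = #|bijs V|%:R * \sum_v F v.
  rewrite exchange_big /= (eq_bigr (fun=> \sum_v F v)).
    by rewrite sumr_const mulr_natl.
  move=> t /bijs_bij tB; rewrite [RHS](reindex t) //.
  exact: onW_bij.
rewrite mulrAC -tot (eq_bigr _ (fun j _ => indep j)) sumr_const card_ord.
by rewrite -[_ *+ _]mulr_natr mulfK.
Qed.

(** As [psi] ignores the profile, the type of agent [i] is uniform and independent of the
    signals. *)
Lemma Ejoint_anonymous k (psi : {ffun V -> 'I_k} -> R) (i : agent V)
    (F : V -> {ffun V -> 'I_k} -> R) :
  Ejoint (fun=> psi) (fun t a => F (t i) a) =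
  #|V|%:R^-1 * \sum_a psi a * \sum_v F v a.
Proof.
rewrite /Ejoint exchange_big mulr_sumr /=; apply: eq_bigr => a _.
have b0 : #|bijs V|%:R != 0 :> R by rewrite gt_eqF ?card_bijs_gt0.
rewrite -mulr_sumr (sum_bijs i (F^~ a)) mulrACA.
by rewrite [_ * (_ / _)]mulrA mulVf // mul1r.
Qed.

Lemma anonymous_scheme W k (sig : 'I_k -> R) (psi : {ffun V -> 'I_k} -> R) :
  injective sig -> (forall j, 0 <= sig j <= 1) ->
  (forall a, 0 <= psi a) -> \sum_a psi a = 1 ->
  (forall j, let S := \sum_a psi a * \sum_v (a v == j)%:R *
                               slack W (fun v => sig (a v)) v in
             0 <= S /\ (0 < sig j -> S = 0)) ->
  [/\ is_scheme sig (fun=> psi), persuasive W sig (fun=> psi) &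
      cost sig (fun=> psi) = \sum_a psi a * \sum_v sig (a v)].
Proof.
move=> sigI sig01 psi0 psi1 H.
have sch : is_scheme sig (fun _ : profile V => psi) by split.
split=> //.
  apply/(persuasive_slack _ sch) => i j _; have [S0 Seq] := H j.
  have -> : signal_slack W sig (fun=> psi) i j =
      #|V|%:R^-1 * \sum_a psi a * \sum_v (a v == j)%:R *
                               slack W (fun v => sig (a v)) v.
    rewrite -(Ejoint_anonymous psi i (fun v a => (a v == j)%:R *
      slack W (fun v => sig (a v)) v)); apply: eq_Ejoint => t a _.
    by rewrite (inj_eq sigI).
  split; first by rewrite mulr_ge0 ?invr_ge0.
  by move=> sj; rewrite Seq // mulr0.
rewrite /cost /Ejoint exchange_big /=; apply: eq_bigr => a _.
rewrite -mulr_suml -mulr_suml sumr_const -[X in X * _ * _]mulr_natl mulfV ?mul1r //.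
by rewrite gt_eqF ?card_bijs_gt0.
Qed.

End Averaging.

(** * Mixtures of product laws on signal vectors *)

Section ProductLaws.
Variables (R : realType) (V : finType).
Implicit Types (W : V -> V -> R) (k : nat).

Definition prod_law k (x : V -> 'I_k -> R) (a : {ffun V -> 'I_k}) : R :=
  \prod_v x v (a v).

Definition mean k (sig : 'I_k -> R) (x : 'I_k -> R) : R := \sum_j x j * sig j.

(** Independence across vertices is distributivity of products over sums; taking [h] equal to 1
    outside one or two vertices gives the marginals. *)
Lemma sum_prod_law k (x h : V -> 'I_k -> R) :
  \sum_a prod_law x a * \prod_v h v (a v) = \prod_v \sum_j x v j * h v j.
Proof.
rewrite bigA_distr_bigA; apply: eq_bigr => a _.
by rewrite /prod_law -big_split.
Qed.

Section Marginals.
Variables (k : nat) (x : V -> 'I_k -> R).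
Hypothesis x1 : forall v, \sum_j x v j = 1.

Lemma prod_law_total : \sum_a prod_law x a = 1.
Proof.
transitivity (\sum_a prod_law x a * \prod_v (fun=> 1) (a v)).
  by apply: eq_bigr => a _; rewrite big1_eq mulr1.
rewrite (sum_prod_law x (fun _ _ => 1)); apply: big1 => v _; rewrite -[RHS](x1 v).
by apply: eq_bigr => j _; rewrite mulr1.
Qed.

Lemma prod_law_marginal v (f : 'I_k -> R) :
  \sum_a prod_law x a * f (a v) = \sum_j x v j * f j.
Proof.
pose h u j := if u == v then f j else 1.
transitivity (\sum_a prod_law x a * \prod_u h u (a u)).
  apply: eq_bigr => a _; congr (_ * _).
  rewrite (bigD1 v) //= big1 ?mulr1 => [|u /negbTE uv]; last by rewrite /h uv.
  by rewrite /h eqxx.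
rewrite sum_prod_law (bigD1 v) //= [X in _ * X]big1 ?mulr1 => [|u /negbTE uv].
  by rewrite /h eqxx.
by rewrite /h uv -[RHS](x1 u); apply: eq_bigr => j _; rewrite mulr1.
Qed.

Lemma prod_law_marginal2 v u (f g : 'I_k -> R) : u != v ->
  \sum_a prod_law x a * (f (a v) * g (a u)) =
  (\sum_j x v j * f j) * (\sum_j x u j * g j).
Proof.
move=> uv; pose h w j := if w == v then f j else if w == u then g j else 1.
transitivity (\sum_a prod_law x a * \prod_w h w (a w)).
  apply: eq_bigr => a _; congr (_ * _).
  rewrite (bigD1 v) //= (bigD1 u) //= big1 ?mulr1 => [|w /andP[/negbTE wv /negbTE wu]].
    by rewrite /h eqxx (negbTE uv) eqxx.
  by rewrite /h wv wu.
rewrite sum_prod_law (bigD1 v) //= (bigD1 u) //= [X in _ * (_ * X)]big1 ?mulr1.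
  by rewrite /h eqxx (negbTE uv) eqxx.
move=> w /andP[/negbTE wv /negbTE wu].
by rewrite /h wv wu -[RHS](x1 w); apply: eq_bigr => j _; rewrite mulr1.
Qed.

(** The neighbour sum omits [u = v], so independence replaces each neighbour's signal by its mean
    even on the event that [v] receives [j]. *)
Lemma prod_law_slack W (sig : 'I_k -> R) j :
  \sum_a prod_law x a * (\sum_v (a v == j)%:R * slack W (fun v => sig (a v)) v) =
  \sum_v x v j * (sig j + nbr_sum W (fun u => mean sig (x u)) v - 1).
Proof.
transitivity (\sum_v \sum_a prod_law x a *
    ((a v == j)%:R * slack W (fun u => sig (a u)) v)).
  by rewrite exchange_big; apply: eq_bigr => a _ /=; rewrite mulr_sumr.
apply: eq_bigr => v _.
have E1 : \sum_a prod_law x a * (a v == j)%:R = x v j.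
  rewrite (prod_law_marginal v (fun i => (i == j)%:R)) (bigD1 j) //= eqxx mulr1.
  by rewrite big1 ?addr0 // => i /negbTE ->; rewrite mulr0.
have E2 u : u != v -> \sum_a prod_law x a * ((a v == j)%:R * sig (a u)) =
    x v j * mean sig (x u).
  move=> uv; rewrite (prod_law_marginal2 (fun i => (i == j)%:R) sig uv).
  congr (_ * _); rewrite (bigD1 j) //= eqxx mulr1.
  by rewrite big1 ?addr0 // => i /negbTE ->; rewrite mulr0.
have -> : x v j * (sig j + nbr_sum W (fun u => mean sig (x u)) v - 1) =
    (sig j - 1) * x v j + \sum_(u | u != v) W v u * (x v j * mean sig (x u)).
  rewrite mulrBr mulrDr mulr1 mulrBl mul1r /nbr_sum mulr_sumr.
  rewrite addrAC [x v j * sig j]mulrC; congr (_ + _).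
  by apply: eq_bigr => u _; ring.
rewrite -{1}E1 mulr_sumr.
under [X in _ = _ + X]eq_bigr => u uv do rewrite -(E2 u uv) mulr_sumr.
rewrite [X in _ = _ + X]exchange_big -big_split; apply: eq_bigr => a _ /=.
rewrite /slack /nbr_sum; case: eqP => [->|_]; last first.
  by rewrite mul0r !mulr0 big1 ?addr0 // => u _; rewrite mul0r !mulr0.
under eq_bigr => u _ do rewrite mul1r mulrCA.
by rewrite -mulr_sumr !mulr1n /=; ring.
Qed.

End Marginals.

(** The constraints are homogeneous in [w], so unnormalised weights suffice; dividing by their sum,
    which is at least 1, does not raise the cost. *)
Lemma mixture_scheme W k (M : finType) (w : M -> R) (x : M -> V -> 'I_k -> R)
    (sig : 'I_k -> R) :
  injective sig -> (forall j, 0 <= sig j <= 1) ->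
  (forall m, 0 <= w m) -> 1 <= \sum_m w m ->
  (forall m v j, 0 <= x m v j) -> (forall m v, \sum_j x m v j = 1) ->
  (forall j, let S := \sum_m w m * \sum_v x m v j *
               (sig j + nbr_sum W (fun u => mean sig (x m u)) v - 1) in
             0 <= S /\ (0 < sig j -> S = 0)) ->
  exists phi : profile V -> {ffun V -> 'I_k} -> R,
    [/\ is_scheme sig phi, persuasive W sig phi &
        cost sig phi <= \sum_m w m * \sum_v mean sig (x m v)].
Proof.
move=> sigI sig01 w0 w1 x0 x1 H; set Z := \sum_m w m in w1.
have Z0 : 0 < Z by apply: lt_le_trans w1.
pose psi a := Z^-1 * \sum_m w m * prod_law (x m) a.
have psiE (f : {ffun V -> 'I_k} -> R) :
    \sum_a psi a * f a = Z^-1 * \sum_m w m * \sum_a prod_law (x m) a * f a.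
  under eq_bigr => a _ do rewrite -mulrA mulr_suml.
  rewrite -mulr_sumr exchange_big; congr (_ * _); apply: eq_bigr => m _ /=.
  by rewrite mulr_sumr; apply: eq_bigr => a _; rewrite mulrA.
have psi0 a : 0 <= psi a.
  apply: mulr_ge0; first by rewrite invr_ge0 ltW.
  by apply: sumr_ge0 => m _; apply: mulr_ge0 => //; apply: prodr_ge0.
have psi1 : \sum_a psi a = 1.
  have := psiE (fun=> 1); under eq_bigr => a _ do rewrite mulr1.
  move=> ->; under eq_bigr => m _.
    under eq_bigr => a _ do rewrite mulr1.
    rewrite (prod_law_total (x1 m)) mulr1; over.
  by rewrite mulVf ?gt_eqF.
have [] := @anonymous_scheme _ _ W _ sig psi sigI sig01 psi0 psi1.
  move=> j; cbv zeta; rewrite psiE; have [S0 Seq] := H j.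
  under eq_bigr => m _ do rewrite (prod_law_slack (x1 m)).
  split; first by apply: mulr_ge0 => //; rewrite invr_ge0 ltW.
  by move=> /Seq ->; rewrite mulr0.
move=> sch per costE; exists (fun=> psi); split=> //.
rewrite costE psiE.
have cE m : \sum_a prod_law (x m) a * \sum_v sig (a v) = \sum_v mean sig (x m v).
  under eq_bigr => a _ do rewrite mulr_sumr.
  rewrite exchange_big; apply: eq_bigr => v _ /=.
  exact: (prod_law_marginal (x1 m)).
under eq_bigr => m _ do rewrite cE.
apply: ler_piMl; last by rewrite invf_le1.
apply: sumr_ge0 => m _; apply: mulr_ge0 => //; apply: sumr_ge0 => v _.
by apply: sumr_ge0 => j _; rewrite mulr_ge0 //; case/andP: (sig01 j).
Qed.

(* A signal value may be used under two labels; when [beta = gamma] the two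
   labels are merged and an unused third value is added. *)
Lemma three_signal_scheme W (M : finType) (w : M -> R) (b c : M -> V -> R)
    (beta gamma : R) :
  0 < beta <= 1 -> 0 < gamma <= 1 ->
  (forall m, 0 <= w m) -> 1 <= \sum_m w m ->
  (forall m v, 0 <= b m v) -> (forall m v, 0 <= c m v) ->
  (forall m v, b m v + c m v <= 1) ->
  let s m v := b m v * beta + c m v * gamma in
  0 <= \sum_m w m * \sum_v (1 - b m v - c m v) * (nbr_sum W (s m) v - 1) ->
  \sum_m w m * (\sum_v b m v * (beta + nbr_sum W (s m) v - 1)) = 0 ->
  \sum_m w m * (\sum_v c m v * (gamma + nbr_sum W (s m) v - 1)) = 0 ->
  exists (sig : 'I_3 -> R) (phi : profile V -> {ffun V -> 'I_3} -> R),
    [/\ is_scheme sig phi, persuasive W sig phi &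
        cost sig phi <= \sum_m w m * \sum_v s m v].
Proof.
move=> /andP[beta0 beta1] /andP[gamma0 gamma1] w0 w1 b0 c0 bc1 s H0 Hb Hc.
pose eqbg := beta == gamma.
pose ga := if eqbg then beta / 2%:R else gamma.
pose sig (j : 'I_3) := nth 0 [:: 0; beta; ga] j.
pose b' m v := if eqbg then b m v + c m v else b m v.
pose c' m v := if eqbg then 0 else c m v.
pose x m v (j : 'I_3) := nth 0 [:: 1 - b m v - c m v; b' m v; c' m v] j.
have ga01 : 0 < ga <= 1 by rewrite /ga; case: ifP => _; lra.
have gab : beta != ga.
  rewrite /ga; case: (boolP eqbg) => // _; apply/eqP => h; lra.
have sigI : injective sig.
  have ga0 : ga != 0 by rewrite gt_eqF //; case/andP: ga01.
  have be0 : beta != 0 by rewrite gt_eqF.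
  move=> [[|[|[|i]]] Hi] [[|[|[|j]]] Hj] //= /eqP; rewrite /sig /=;
    rewrite ?(negbTE gab) ?[ga == beta]eq_sym ?(negbTE gab)
            ?[0 == _]eq_sym ?(negbTE ga0) ?(negbTE be0) // => _; exact/val_inj.
have meanE m v : mean sig (x m v) = s m v.
  rewrite /mean !big_ord_recl big_ord0 /x /sig /= /b' /c' /ga /s.
  case: (boolP eqbg) => [/eqP <-|_]; ring.
have nbrE m v : nbr_sum W (fun u => mean sig (x m u)) v = nbr_sum W (s m) v.
  by apply: eq_bigr => u _; rewrite meanE.
have [] := @mixture_scheme W _ M w x sig sigI _ w0 w1.
- move=> [[|[|[|j]]] Hj] //=; rewrite /sig /=; lra.
- move=> m v [[|[|[|j]]] Hj] //=; rewrite /x /= /b' /c'; have := bc1 m v;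
    have := b0 m v; have := c0 m v; first lra; case: ifP => _; lra.
- move=> m v; rewrite !big_ord_recl big_ord0 /x /= /b' /c'.
  case: ifP => _; ring.
- move=> j; cbv zeta.
  under eq_bigr => m _ do under eq_bigr => v _ do rewrite nbrE.
  case: j => [[|[|[|j]]] Hj] //=; rewrite /sig /x /=.
  + split; last by rewrite ltxx.
    under eq_bigr => m _ do under eq_bigr => v _ do rewrite add0r.
    exact: H0.
  + suff -> : \sum_m w m * (\sum_v b' m v * (beta + nbr_sum W (s m) v - 1)) = 0.
      by [].
    rewrite /b'; case: (boolP eqbg) => [/eqP e|_ //].
    (* With merged labels, the condition for [beta] is the sum of the two given equations. *)
    have := congr2 +%R Hb Hc; rewrite addr0 => bc; rewrite -[RHS]bc.
    rewrite -e -big_split; apply: eq_bigr => m _ /=.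
    rewrite -mulrDr -big_split; congr (_ * _); apply: eq_bigr => v _ /=; ring.
  + suff -> : \sum_m w m * (\sum_v c' m v * (ga + nbr_sum W (s m) v - 1)) = 0.
      by [].
    rewrite /c' /ga; case: (boolP eqbg) => [_|_ //].
    by rewrite big1 // => m _; rewrite big1 ?mulr0 // => v _; rewrite mul0r.
move=> phi [? ? cs]; exists sig, phi; split=> //; apply: le_trans cs _.
by under eq_bigr => m _ do under eq_bigr => v _ do rewrite meanE.
Qed.

End ProductLaws.

(** * Weighted graphs and the constant scheme *)

Section Schemes.
Variables (R : realType) (V : finType) (W : V -> V -> R).
Hypothesis wW : is_weight W.
Local Notation n := (#|V|%:R).
Local Notation D := (nbr_sum W).

Lemma weight_sym u v : W u v = W v u. Proof. by case: wW. Qed.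
Lemma weight_ge0 u v : 0 <= W u v. Proof. by case: wW => _ [/(_ u v)/andP[]]. Qed.
Lemma weight_le1 u v : W u v <= 1. Proof. by case: wW => _ [/(_ u v)/andP[]]. Qed.
Lemma weight_diag v : W v v = 1. Proof. by case: wW => _ []. Qed.

Lemma nbr_sum_ge0 x v : (forall u, 0 <= x u) -> 0 <= D x v.
Proof. by move=> x0; apply: sumr_ge0 => u _; rewrite mulr_ge0 ?weight_ge0. Qed.

Lemma nbr_sumZ c x v : D (fun u => c * x u) v = c * D x v.
Proof. by rewrite /nbr_sum mulr_sumr; apply: eq_bigr => u _; rewrite mulrCA. Qed.

Lemma eq_nbr_sum x y v : x =1 y -> D x v = D y v.
Proof. by move=> xy; apply: eq_bigr => u _; rewrite xy. Qed.

Lemma row_sumE x v : \sum_u W v u * x u = x v + D x v.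
Proof. by rewrite (bigD1 v) //= weight_diag mul1r. Qed.

(** Adding the diagonal terms back turns both sides into full double sums, which agree because [W]
    is symmetric. *)
Lemma nbr_sum_sym x y : \sum_v x v * D y v = \sum_v y v * D x v.
Proof.
have E x' y' : \sum_v x' v * D y' v =
    (\sum_v \sum_u W v u * (x' v * y' u)) - \sum_v x' v * y' v.
  apply/eqP; rewrite eq_sym subr_eq -big_split; apply/eqP/eq_bigr => v _ /=.
  rewrite -mulrDr addrC -row_sumE mulr_sumr.
  by apply: eq_bigr => u _; rewrite mulrCA.
rewrite !E exchange_big; congr (_ - _); last by apply: eq_bigr => v _; rewrite mulrC.
apply: eq_bigr => v _; apply: eq_bigr => u _.
by rewrite weight_sym [y v * _]mulrC.
Qed.

Lemma sum_cst (c : R) : \sum_(v : V) c = n * c.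
Proof. by rewrite sumr_const mulr_natl. Qed.

(** Every edge counts twice and the diagonal contributes [n]. *)
Definition total_weight : R := \sum_v \sum_u W v u.

Lemma total_weightE : total_weight = n + \sum_v D (fun=> 1) v.
Proof.
rewrite -[n]mulr1 -sum_cst -big_split; apply: eq_bigr => v _ /=.
by rewrite -row_sumE; apply: eq_bigr => u _; rewrite mulr1.
Qed.

Lemma total_weight_ge : n <= total_weight.
Proof.
by rewrite total_weightE lerDl; apply: sumr_ge0 => v _; apply: nbr_sum_ge0.
Qed.

(** The signal [n / total_weight] makes the slacks sum to zero over all vertices, which suffices
    because types are averaged out. *)
Lemma constant_scheme : 0 < n :> R ->
  exists (sig : 'I_3 -> R) (phi : profile V -> {ffun V -> 'I_3} -> R),
    [/\ is_scheme sig phi, persuasive W sig phi &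
        cost sig phi <= n ^+ 2 / total_weight].
Proof.
move=> n0; have tn := total_weight_ge.
have t0 : 0 < total_weight by lra.
pose be := n / total_weight.
have be0 : 0 < be <= 1 by rewrite divr_gt0 //= ler_pdivrMr ?mul1r.
have sE v : D (fun u => 1 * be + 0 * be) v = be * D (fun=> 1) v.
  by rewrite -nbr_sumZ; apply: eq_nbr_sum => u; ring.
have [] := @three_signal_scheme _ _ W unit (fun=> 1) (fun _ _ => 1)
  (fun _ _ => 0) be be be0 be0.
- by [].
- by rewrite big_const card_unit /= addr0.
- by [].
- by [].
- by move=> _ v; rewrite addr0.
- rewrite big_const card_unit /= addr0 mul1r big1 // => v _.
  by rewrite subrr subr0 mul0r.
- rewrite big_const card_unit /= addr0 mul1r.
  under eq_bigr => v _ do rewrite mul1r sE.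
  rewrite !big_split /= !sum_cst -mulr_sumr.
  have -> : n * be + be * (\sum_v D (fun=> 1) v) + n * -1 = be * total_weight - n.
    by rewrite total_weightE; ring.
  by rewrite divfK ?subrr ?gt_eqF.
- rewrite big_const card_unit /= addr0 mul1r big1 // => v _.
  by rewrite mul0r.
move=> sig [phi [? ? cs]]; exists sig, phi; split=> //; apply: le_trans cs _.
rewrite big_const card_unit /= addr0 mul1r mul1r mul0r addr0 sum_cst.
by rewrite expr2 mulrA.
Qed.

(** * The three-mode scheme *)

Section Core.
Variables (th y : V -> R) (T e lam : R).
Hypothesis th01 : forall v, 0 <= th v <= 1.
Hypothesis thF : feasible W th.
Local Notation k := (\sum_v th v).
Hypothesis y01 : forall v, 0 <= y v <= 1.
Hypotheses (T0 : 0 < T) (en : e * n = T) (Tn : 256%:R * T <= n) (kT : 16%:R * k <= T).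
Hypothesis tot_small : total_weight * T <= n ^+ 2.
(** [lam] bounds the deficit of the [y]-mode from below; [lamT] then bounds [p * n] by [4 T] for the
    weight [p] of that mode. *)
Hypotheses (lam0 : 0 < lam) (lamT : n * k ^+ 2 <= 4%:R * T * lam).
Hypothesis lamP : \sum_v y v * (D y v - e) <= - lam.

Let n0 : 0 < n :> R. Proof. by apply: lt_le_trans Tn; rewrite mulr_gt0. Qed.
Let T_ge0 : 0 <= T := ltW T0.
Let n_ge0 : 0 <= n :> R := ltW n0.
Let th_ge0 v : 0 <= th v. Proof. by case/andP: (th01 v). Qed.
Let th_le1 v : th v <= 1. Proof. by case/andP: (th01 v). Qed.
Let y_ge0 v : 0 <= y v. Proof. by case/andP: (y01 v). Qed.
Let y_le1 v : y v <= 1. Proof. by case/andP: (y01 v). Qed.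
Let k_ge0 : 0 <= k. Proof. exact: sumr_ge0. Qed.
Let D_th v : 1 - th v <= D th v.
Proof. by have [_ /(_ v)] := thF; rewrite row_sumE; lra. Qed.

Lemma total_ge1 : 1 <= k.
Proof.
have /card_gt0P[v _] : (0 < #|V|)%N by rewrite -(ltr0n R).
have [_ /(_ v) h] := thF; apply: le_trans h _.
apply: ler_sum => u _; rewrite -[leRHS]mul1r; apply: ler_wpM2r => //.
exact: weight_le1.
Qed.

Let excess_ub : \sum_v th v * D th v <= k ^+ 2.
Proof.
rewrite expr2 mulr_suml; apply: ler_sum => v _; apply: ler_wpM2l => //.
rewrite /nbr_sum [leRHS](bigD1 v) //= ler_wpDl //.
apply: ler_sum => u _; rewrite -[leRHS]mul1r; apply: ler_wpM2r => //.
exact: weight_le1.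
Qed.

(* Either lowering [beta] below 1 balances the bulk mode by itself, or its
   excess, at most [k ^ 2], is absorbed by the [y]-mode with weight [p]. *)
Lemma bulk_balance : exists be p : R,
  [/\ 1 - e <= be <= 1, 0 < be, 0 <= p, p * n <= 4%:R * T &
      \sum_v th v * (be + be * D th v - 1) +
        p * \sum_v y v * (be + be * D y v - 1) = 0].
Proof.
have k1 := total_ge1.
pose A := \sum_v th v * (1 + D th v).
have SE be : \sum_v th v * (be + be * D th v - 1) = be * A - k.
  by rewrite /A mulr_sumr -sumrB; apply: eq_bigr => v _; ring.
have AE : A = k + \sum_v th v * D th v.
  by rewrite /A -big_split; apply: eq_bigr => v _ /=; ring.
have Ak : k <= A.
  rewrite AE lerDl; apply: sumr_ge0 => v _.
  by rewrite mulr_ge0 // nbr_sum_ge0.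
have A0 : 0 < A by lra.
have eT : e = T / n by rewrite -en mulfK ?gt_eqF.
have e0 : 0 <= e by rewrite eT divr_ge0 ?ltW.
have e1 : e <= 1 / 256%:R by rewrite eT ler_pdivrMr //; move: Tn; lra.
have [h|h] := lerP (1 - e) (k / A).
  exists (k / A), 0; split=> //.
  - by rewrite h /= ler_pdivrMr ?mul1r.
  - by rewrite divr_gt0 //; lra.
  - by rewrite mul0r; apply: mulr_ge0.
  - by rewrite SE mul0r addr0 divfK ?subrr ?gt_eqF.
move: h; have [be beE] : exists be : R, be = 1 - e by eexists.
rewrite -beE => h.
have be1 : be <= 1 by lra.
have be0 : 0 < be by lra.
(* Since [be - 1 = - e] and [be <= 1] only shrinks the neighbour terms, the deficit stays at least
   [lam]. *)
have LP : lam <= - \sum_v y v * (be + be * D y v - 1).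
  rewrite -lerN2 opprK; apply: le_trans lamP; apply: ler_sum => v _.
  apply: ler_wpM2l => //.
  have : be * D y v <= D y v by rewrite ler_piMl // nbr_sum_ge0.
  lra.
set L := - _ in LP.
have L0 : 0 < L := lt_le_trans lam0 LP.
set S := be * A - k.
have S0 : 0 <= S.
  by rewrite subr_ge0; move: h; rewrite ltr_pdivrMr //; apply: ltW.
have Sk : S <= k ^+ 2.
  have : be * A <= A by apply: ler_piMl => //; apply: ltW.
  by have := excess_ub; rewrite /S AE; clearbody A; lra.
(* At this weight the deficit [L] of the [y]-mode cancels the bulk excess [S]. *)
exists be, (S / L); split=> //.
- by rewrite lexx.
- by rewrite divr_ge0 // ltW.
- rewrite mulrAC ler_pdivrMr //.
  apply: (@le_trans _ _ (k ^+ 2 * n)); first by apply: ler_wpM2r.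
  by rewrite mulrC; apply: le_trans lamT _; apply: ler_wpM2l => //; apply: mulr_ge0.
have -> : \sum_v y v * (be + be * D y v - 1) = - L by rewrite opprK.
by rewrite SE -/S mulrN divfK ?subrr ?gt_eqF.
Qed.

Lemma mixed_scheme :
  exists (sig : 'I_3 -> R) (phi : profile V -> {ffun V -> 'I_3} -> R),
    [/\ is_scheme sig phi, persuasive W sig phi & cost sig phi <= 15%:R * T].
Proof.
have k1 := total_ge1.
have [be [p [/andP[bel be1] be0 p0 pn beP]]] := bulk_balance.
pose z v := 1 - th v.
have z0 v : 0 <= z v by rewrite subr_ge0.
have zk : \sum_v z v = n - k by rewrite sumrB sum_cst mulr1.
have nk : 4096%:R * k <= n by move: Tn kT; lra.
pose W' := \sum_v z v * D z v.
have W'0 : 0 <= W' by apply: sumr_ge0 => v _; rewrite mulr_ge0 // nbr_sum_ge0.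
have W't : n - k + W' <= total_weight.
  rewrite total_weightE; apply: lerD; first by lra.
  apply: ler_sum => v _; apply: (@le_trans _ _ (D z v)).
    by rewrite ler_piMl ?nbr_sum_ge0 // /z gerBl.
  apply: ler_sum => u _; apply: ler_wpM2l; first exact: weight_ge0.
  by rewrite /z gerBl.
(* Chosen so that the slack of [gamma] in its mode sums to zero: [ga * (n - k + W') = n - k]. *)
set ga := (n - k) / (n - k + W').
have den0 : 0 < n - k + W' by lra.
have ga0 : 0 < ga by rewrite divr_gt0 //; lra.
have ga1 : ga <= 1 by rewrite ler_pdivrMr // mul1r; lra.
have gaT : T / 2%:R <= ga * n.
  rewrite /ga mulrAC ler_pdivlMr //.
  apply: (@le_trans _ _ (T / 2%:R * total_weight)).
    by rewrite ler_wpM2l ?W't // divr_ge0 // ltW.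
  apply: (@le_trans _ _ (n ^+ 2 / 2%:R)); first by move: tot_small; lra.
  rewrite expr2 mulrAC ler_wpM2r ?ltW //; lra.
have gaE : \sum_v z v * (ga + ga * D z v - 1) = 0.
  have -> : \sum_v z v * (ga + ga * D z v - 1) = ga * (n - k + W') - (n - k).
    rewrite -zk /W' mulrDr !mulr_sumr -big_split -sumrB.
    by apply: eq_bigr => v _ /=; ring.
  by rewrite divfK ?subrr ?gt_eqF.
set Z2 := \sum_v th v * (ga * D z v - 1).
(* [Z2] is the slack at the receivers of 0 in the [gamma]-mode. By symmetry it is [ga] times the sum
   of [z v * D th v], minus [k]; feasibility gives [D th >= z], and [k] is at most [ga * n / 8]. *)
have Z2P : ga * n / 2%:R <= Z2.
  have -> : Z2 = ga * (\sum_v z v * D th v) - k.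
    rewrite -nbr_sum_sym mulr_sumr -sumrB.
    by apply: eq_bigr => v _; ring.
  have : n - 2%:R * k <= \sum_v z v * D th v.
    have -> : n - 2%:R * k = \sum_v (1 - 2%:R * th v).
      by rewrite sumrB sum_cst mulr1 mulr_sumr.
    apply: ler_sum => v _; apply: (@le_trans _ _ (z v * z v)).
      by have := sqr_ge0 (th v); rewrite /z; lra.
    by apply: ler_wpM2l => //; apply: D_th.
  move=> /(ler_wpM2l (ltW ga0)); rewrite mulrBr.
  have : ga * (4096%:R * k) <= ga * n by rewrite ler_wpM2l // ltW.
  by move: kT gaT; lra.
have gan0 : 0 < ga * n by rewrite mulr_gt0.
have Z20 : 0 < Z2 by lra.
(* Just enough weight to pay for the deficits at signal 0: [T + k] in the bulk and [n] per unit
   weight in the [y]-mode. *)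
pose q := (T + k + p * n) / Z2.
have num0 : 0 <= T + k + p * n.
  by rewrite !addr_ge0 // mulr_ge0.
have q0 : 0 <= q by rewrite divr_ge0 // ltW.
have qZ : q * Z2 = T + k + p * n by rewrite divfK ?gt_eqF.
pose w (m : 'I_3) := nth 0 [:: 1; p; q] m.
pose b (m : 'I_3) v := nth 0 [:: th v; y v; 0] m.
pose c (m : 'I_3) v := nth 0 [:: 0; 0; z v] m.
have w_ge0 m : 0 <= w m by case: m => [[|[|[|m]]] Hm].
have b_ge0 m v : 0 <= b m v by case: m => [[|[|[|m]]] Hm].
have c_ge0 m v : 0 <= c m v by case: m => [[|[|[|m]]] Hm].
have bc m v : b m v + c m v <= 1.
  by case: m => [[|[|[|m]]] Hm]; rewrite /b /c /= ?addr0 ?add0r // /z gerBl.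
have D0 x v : D (fun u => x u * be + 0 * ga) v = be * D x v.
  by rewrite -nbr_sumZ; apply: eq_nbr_sum => u; ring.
have D1 x v : D (fun u => 0 * be + x u * ga) v = ga * D x v.
  by rewrite -nbr_sumZ; apply: eq_nbr_sum => u; ring.
have [] := @three_signal_scheme _ _ W _ w b c be ga _ _ w_ge0 _ b_ge0 c_ge0 bc.
- by rewrite be0.
- by rewrite ga0.
- by rewrite !big_ord_recl big_ord0 /w /=; lra.
- rewrite !big_ord_recl big_ord0 /w /b /c /=.
  under eq_bigr => v _ do rewrite D0.
  under [X in _ <= _ + (_ * X + _)]eq_bigr => v _ do rewrite D0.
  under [X in _ <= _ + (_ + (_ * X + _))]eq_bigr => v _ do rewrite D1.
  (* Receivers of 0 in the bulk see at least [be * z v]; expanding [z (be z - 1)] with [be >= 1 - e]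
     leaves a deficit of at most [e + th v]. *)
  have B0 : - (T + k) <= \sum_v (1 - th v - 0) * (be * D th v - 1).
    have -> : - (T + k) = \sum_v (- e - th v).
      by rewrite sumrB sum_cst mulrN [n * e]mulrC en opprD.
    apply: ler_sum => v _; rewrite subr0.
    apply: (@le_trans _ _ (z v * (be * z v - 1))); last first.
      by apply: ler_wpM2l => //; rewrite lerD2r ler_wpM2l ?(ltW be0) ?D_th.
    have e0 : 0 <= 1 - be by lra.
    have := mulr_ge0 e0 (th_ge0 v).
    have := mulr_ge0 (ltW be0) (mulr_ge0 (th_ge0 v) (th_ge0 v)).
    by rewrite /z; lra.
  have B1 : - n <= \sum_v (1 - y v - 0) * (be * D y v - 1).
    have -> : - n = \sum_(v : V) (-1 : R) by rewrite sum_cst mulrN1.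
    apply: ler_sum => v _; rewrite subr0.
    have yv : 0 <= 1 - y v by rewrite subr_ge0.
    have := mulr_ge0 yv (mulr_ge0 (ltW be0) (nbr_sum_ge0 v y_ge0)).
    by have := y_ge0 v; lra.
  have -> : \sum_v (1 - 0 - z v) * (ga * D z v - 1) = Z2.
    by apply: eq_bigr => v _; rewrite /z; ring.
  rewrite qZ; have := ler_wpM2l p0 B1; lra.
- rewrite !big_ord_recl big_ord0 /w /b /c /=.
  under eq_bigr => v _ do rewrite D0.
  under [X in _ + (_ * X + _)]eq_bigr => v _ do rewrite D0.
  rewrite [X in _ + (_ + (_ * X + _))]big1; last by move=> v _; rewrite mul0r.
  by rewrite mul1r mulr0 !addr0.
- rewrite !big_ord_recl big_ord0 /w /b /c /=.
  rewrite big1; last by move=> v _; rewrite mul0r.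
  rewrite [X in _ + (_ * X + _)]big1; last by move=> v _; rewrite mul0r.
  under eq_bigr => v _ do rewrite D1.
  by rewrite gaE !mulr0 !addr0.
move=> sig [phi [? ? cs]]; exists sig, phi; split=> //; apply: le_trans cs _.
rewrite !big_ord_recl big_ord0 /w /b /c /=.
have C0 : \sum_v (th v * be + 0 * ga) <= k.
  by apply: ler_sum => v _; rewrite mul0r addr0 ler_piMr.
have C1 : \sum_v (y v * be + 0 * ga) <= n.
  have <- : \sum_(v : V) (1 : R) = n by rewrite sum_cst mulr1.
  apply: ler_sum => v _; rewrite mul0r addr0.
  by apply: mulr_ile1 => //; apply: ltW.
have C2 : \sum_v (0 * be + z v * ga) <= ga * n.
  have <- : \sum_(v : V) ga = ga * n by rewrite sum_cst mulrC.
  apply: ler_sum => v _.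
  by rewrite mul0r add0r ler_piMl ?(ltW ga0) // /z gerBl.
(* The modes cost at most [k], [p n] and [q ga n <= 2 (T + k + p n)]; with [p n <= 4 T] and
   [16 k <= T] the sum is below [15 T]. *)
have := ler_wpM2l p0 C1; have := ler_wpM2l q0 C2.
have : q * (ga * n) <= 2%:R * (q * Z2).
  by rewrite [leRHS]mulrCA; apply: ler_wpM2l => //; lra.
by rewrite qZ; move: kT pn T0; lra.
Qed.

End Core.
End Schemes.

(** * Independent sets in graphs of small average degree *)

Section IndependentSet.
Variables (V : finType) (e : rel V).
Hypotheses (e_sym : symmetric e) (e_irr : irreflexive e).
Local Notation deg v := #|[set u | e v u]|.
Local Notation E := (\sum_v deg v)%N.

(* A Turan-type bound: greedily choose among the vertices whose degree is at
   most twice the average. *)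
Lemma large_independent_set : exists I : {set V},
  (forall u v, u \in I -> v \in I -> ~~ e u v) /\
  (#|V| ^ 2 <= #|I| * (2 * #|V| + 4 * E))%N.
Proof.
set n := #|V|.
pose L := [set v | n * deg v <= 2 * E]%N.
(* Markov's inequality: at most half of the vertices exceed twice the average degree [E / n]. *)
have Lbig : (n <= 2 * #|L|)%N.
  have [E0|Epos] := posnP E.
    suff -> : #|L| = n by rewrite mul2n -addnn leq_addr.
    apply: eq_card => v; rewrite !inE E0.
    by move/eqP: E0; rewrite sum_nat_eq0 => /forallP/(_ v)/eqP ->; rewrite muln0.
  have : (#|~: L| * (2 * E) <= n * E)%N.
    rewrite -sum_nat_const [leqRHS]big_distrr /= [leqRHS](bigID (mem (~: L))) /=.
    apply: leq_trans (leq_addr _ _); apply: leq_sum => v.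
    by rewrite !inE -ltnNge => /ltnW.
  rewrite mulnA leq_pmul2r // => h.
  by rewrite -[n](cardsC L) in h *; lia.
pose indep (I : {set V}) :=
  (I \subset L) && [forall u in I, forall v in I, ~~ e u v].
(* A maximal independent subset of [L] stands in for the greedy choice; by maximality the closed
   neighbourhoods of its members cover [L]. *)
have [I] : {I | maxset indep I}.
  apply: ex_maxset; exists set0; rewrite /indep sub0set.
  by apply/forall_inP => u; rewrite inE.
case/maxsetP => /andP[IL /forall_inP Iind] Imax.
have indI u v : u \in I -> v \in I -> ~~ e u v.
  by move=> uI; move: v; apply/forall_inP; apply: Iind.
exists I; split=> //.
have cover : L \subset \bigcup_(v in I) (v |: [set u | e v u]).
  apply/subsetP => v vL; apply/bigcupP.
  case: (boolP [exists u in I, e u v]) => [/exists_inP[u uI euv]|].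
    by exists u; rewrite // !inE euv orbT.
  rewrite negb_exists_in => /forall_inP nov; exists v; last by rewrite setU11.
  have <- : v |: I = I; last exact: setU11.
  apply: Imax; last exact: subsetUr.
  rewrite /indep subUset sub1set vL IL; apply/forall_inP => u uvI.
  apply/forall_inP => w wvI; move: uvI wvI; rewrite !inE.
  case/orP=> [/eqP ->|uI] /orP[/eqP ->|wI].
  - by rewrite e_irr.
  - by rewrite e_sym nov.
  - exact: nov.
  - exact: indI.
have Lle : (n * #|L| <= #|I| * (n + 2 * E))%N.
  apply: (@leq_trans (n * \sum_(v in I) (1 + deg v))).
    rewrite leq_mul2l; apply/orP; right.
    apply: leq_trans (subset_leq_card cover) _.
    have := leq_card_setU; elim/big_rec2: _ => [|v m A _ IH _]; first by rewrite cards0.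
    apply: leq_trans (leq_card_setU _ _) _; apply: leq_add; last exact: IH leq_card_setU.
    by apply: leq_trans (leq_card_setU _ _) _; rewrite cards1.
  rewrite big_distrr -sum_nat_const /=; apply: leq_sum => v vI.
  rewrite mulnDr muln1 leq_add2l.
  by move/subsetP: IL => /(_ v vI); rewrite inE.
by rewrite expnS expn1; nia.
Qed.
End IndependentSet.

(** * Choice of the rare mode and of the target cost *)

Section UpperBounds.
Variables (R : realType) (V : finType) (W : V -> V -> R).
Hypothesis wW : is_weight W.
Local Notation n := (#|V|%:R).
Variable th : V -> R.
Hypothesis th01 : forall v, 0 <= th v <= 1.
Hypothesis thF : feasible W th.
Local Notation k := (\sum_v th v).
Hypothesis n0 : 0 < n :> R.

Let n1 : 1 <= n :> R.
Proof. by move: n0; rewrite ltr0n ler1n. Qed.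

(** If [n < 256 T], the constant scheme costs at most [n]; if the total weight exceeds [n^2 / T], it
    costs less than [T]; otherwise the three-mode scheme applies. The bound on [k] is [16 k <= T]
    squared. *)
Lemma scheme_of_mode (T : R) : 0 < T ->
  (256%:R * T <= n -> 256%:R * k ^+ 2 <= T ^+ 2) ->
  (256%:R * T <= n -> total_weight W * T <= n ^+ 2 ->
   exists (y : V -> R) (lam : R),
   [/\ forall v, 0 <= y v <= 1, 0 < lam, n * k ^+ 2 <= 4%:R * T * lam &
       \sum_v y v * (nbr_sum W y v - T / n) <= - lam]) ->
  exists (sig : 'I_3 -> R) (phi : profile V -> {ffun V -> 'I_3} -> R),
    [/\ is_scheme sig phi, persuasive W sig phi & cost sig phi <= 256%:R * T].
Proof.
move=> T0 kT mode; have tn := total_weight_ge wW.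
have [sig [phi [sch per cs]]] := constant_scheme wW n0.
have tot0 : 0 < total_weight W by apply: lt_le_trans tn.
have [nT|Tn] := ltrP n (256%:R * T).
  exists sig, phi; split=> //; apply: le_trans cs _; apply: le_trans (ltW nT).
  by rewrite ler_pdivrMr // expr2; apply: ler_wpM2l => //; apply: ltW.
have [tT|Tt] := ltrP (n ^+ 2) (total_weight W * T).
  exists sig, phi; split=> //; apply: le_trans cs _.
  apply: (@le_trans _ _ T); first by rewrite ler_pdivrMr // mulrC ltW.
  by lra.
have [y [lam [y01 lam0 lamT lamP]]] := mode Tn Tt.
have k16 : 16%:R * k <= T.
  have k0 : 0 <= k by apply: sumr_ge0 => v _; case/andP: (th01 v).
  rewrite -(@ler_pXn2r _ 2%N) ?nnegrE ?(ltW T0) ?mulr_ge0 //.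
  by have := kT Tn; rewrite exprMn -natrX.
have en : T / n * n = T by rewrite divfK ?gt_eqF.
have [sig' [phi' [sch' per' cs']]] :=
  mixed_scheme wW th01 thF y01 T0 en Tn k16 Tt lam0 lamT lamP.
exists sig', phi'; split=> //; apply: le_trans cs' _.
by lra.
Qed.

(** With total weight [t], a constant [y = r] has total slack [r (r (t - n) - T)], at most
    [- r T / 2] for [r = T / (2 t)]. Given [t T <= n^2], the requirement on [lam] follows from
    [n^3 k^2 = T^4]. *)
Lemma scheme_any_weights (T : R) : 0 < T -> T ^+ 4 = n ^+ 3 * k ^+ 2 ->
  exists (sig : 'I_3 -> R) (phi : profile V -> {ffun V -> 'I_3} -> R),
    [/\ is_scheme sig phi, persuasive W sig phi & cost sig phi <= 256%:R * T].
Proof.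
move=> T0 TE; have n3 : 0 < n ^+ 3 :> R by rewrite exprn_gt0.
have tn := total_weight_ge wW.
have tot0 : 0 < total_weight W by apply: lt_le_trans tn.
apply: scheme_of_mode => // Tn.
  rewrite -(ler_pM2l n3) mulrCA -TE.
  have -> : 256%:R * T ^+ 4 = (256%:R * T) * T * T ^+ 2 by ring.
  apply: ler_wpM2r; first by rewrite exprn_ge0 // ltW.
  apply: (@le_trans _ _ (n * n)); last by rewrite exprSr expr2 ler_peMr // mulr_ge0 // ltW.
  by apply: ler_pM => //; lra.
move=> Tt; set t := total_weight W in tot0 tn Tt *.
pose r := T / (2%:R * t).
have rt : r * t = T / 2%:R by rewrite /r; field; rewrite gt_eqF.
have r0 : 0 < r by rewrite divr_gt0 ?mulr_gt0.
exists (fun=> r), (r * (T / 2%:R)); split.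
- by move=> v; rewrite ltW //= ler_pdivrMr ?mulr_gt0 // mul1r; lra.
- by rewrite mulr_gt0 // divr_gt0.
- rewrite -(ler_pM2l tot0).
  have -> : t * (4%:R * T * (r * (T / 2%:R))) = 2%:R * T ^+ 2 * (r * t) by field.
  rewrite rt -(ler_pM2r T0).
  have -> : 2%:R * T ^+ 2 * (T / 2%:R) * T = T ^+ 4 by field.
  rewrite TE mulrAC.
  have -> : n ^+ 3 * k ^+ 2 = n ^+ 2 * (n * k ^+ 2) by ring.
  by apply: ler_wpM2r => //; rewrite mulr_ge0 ?sqr_ge0 // (ltW n0).
have -> : \sum_v r * (nbr_sum W (fun=> r) v - T / n) = r * (r * (t - n) - T).
  have E v : nbr_sum W (fun=> r) v = r * nbr_sum W (fun=> 1) v.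
    by rewrite -nbr_sumZ; apply: eq_nbr_sum => u; rewrite mulr1.
  rewrite -mulr_sumr sumrB sum_cst mulrCA mulfV ?gt_eqF // mulr1.
  under eq_bigr => v _ do rewrite E.
  by rewrite -mulr_sumr /t (total_weightE wW) addrAC subrr add0r.
rewrite -mulrN; apply: ler_wpM2l; first exact: ltW.
have : 0 <= r * n by apply: mulr_ge0; apply: ltW.
by move: rt; lra.
Qed.

(** On an independent set [I] the indicator has no neighbour terms, so its slack is [- |I| T / n]
    and the requirement on [lam] becomes [delta T <= 4 |I|]. This holds because at most
    [(t - n) / delta] ordered pairs are adjacent, [t] being the total weight, and [t T <= n^2]. *)
Lemma scheme_weights_ge (delta T : R) : 0 < delta <= 1 ->
  (forall u v, u != v -> 0 < W u v -> delta <= W u v) ->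
  0 < T -> delta * T ^+ 3 = n ^+ 2 * k ^+ 2 ->
  exists (sig : 'I_3 -> R) (phi : profile V -> {ffun V -> 'I_3} -> R),
    [/\ is_scheme sig phi, persuasive W sig phi & cost sig phi <= 256%:R * T].
Proof.
move=> /andP[d0 d1] Wd T0 TE; have n2 : 0 < n ^+ 2 :> R by rewrite exprn_gt0.
have tn := total_weight_ge wW.
have tot0 : 0 < total_weight W by apply: lt_le_trans tn.
apply: scheme_of_mode => // Tn.
  rewrite -(ler_pM2l n2) mulrCA -TE.
  have -> : 256%:R * (delta * T ^+ 3) = delta * (256%:R * T) * T ^+ 2 by ring.
  apply: ler_wpM2r; first by rewrite exprn_ge0 // ltW.
  apply: (@le_trans _ _ n); last by rewrite expr2 ler_peMr // ltW.
  by apply: le_trans Tn; rewrite ler_piMl // mulr_ge0 // ltW.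
move=> Tt; pose e u v := (u != v) && (0 < W u v).
have e_sym : symmetric e by move=> u v; rewrite /e eq_sym weight_sym.
have e_irr : irreflexive e by move=> u; rewrite /e eqxx.
have [I [Iind Ibig]] := large_independent_set e_sym e_irr.
have Ile : delta * T <= 4%:R * #|I|%:R.
  set E := (\sum_v #|[set u | e v u]|)%N in Ibig.
  have EW : delta * E%:R <= total_weight W - n.
    rewrite total_weightE // addrAC subrr add0r natr_sum mulr_sumr.
    apply: ler_sum => v _; rewrite -sum1_card natr_sum mulr_sumr /nbr_sum.
    rewrite big_mkcond [leRHS]big_mkcond; apply: ler_sum => u _ /=.
    rewrite inE /e eq_sym; case: eqP => [//|/eqP uv] /=.
    rewrite !mulr1; case: ifP => [Wvu|_]; last exact: weight_ge0.
    by apply: Wd; rewrite // eq_sym.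
  have Ibig' : n ^+ 2 <= #|I|%:R * (2%:R * n + 4%:R * E%:R) :> R.
    by rewrite -!natrM -natrD -natrM -natrX ler_nat.
  have nE : delta * (2%:R * n + 4%:R * E%:R) <= 4%:R * total_weight W.
    have : delta * n <= n by rewrite ler_piMl // ltW.
    by rewrite mulrDr [_ * (2%:R * _)]mulrCA [_ * (4%:R * _)]mulrCA; lra.
  rewrite -(ler_pM2l tot0) mulrCA.
  apply: (@le_trans _ _ (delta * n ^+ 2)); first by apply: ler_wpM2l => //; apply: ltW.
  apply: (@le_trans _ _ (#|I|%:R * (delta * (2%:R * n + 4%:R * E%:R)))).
    by rewrite [leRHS]mulrCA; apply: ler_wpM2l => //; apply: ltW.
  by rewrite [leRHS]mulrA [leRHS]mulrC [_ * 4%:R]mulrC; apply: ler_wpM2l.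
have I0 : 0 < #|I|%:R :> R.
  have : 0 < delta * T by rewrite mulr_gt0.
  by move: Ile; lra.
exists (fun v => (v \in I)%:R), (T / n * #|I|%:R); split.
- by move=> v; case: (v \in I); rewrite ?lexx ?ler01.
- by rewrite mulr_gt0 // divr_gt0.
- rewrite -(ler_pM2l n0).
  have -> : n * (4%:R * T * (T / n * #|I|%:R)) = T ^+ 2 * (4%:R * #|I|%:R).
    by field; rewrite gt_eqF.
  have -> : n * (n * k ^+ 2) = T ^+ 2 * (delta * T).
    by transitivity (n ^+ 2 * k ^+ 2); [ring | rewrite -TE; ring].
  by apply: ler_wpM2l => //; rewrite sqr_ge0.
have -> : - (T / n * #|I|%:R) = \sum_v (v \in I)%:R * (- (T / n)).
  rewrite -mulr_suml -mulNr mulrC; congr (_ * _).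
  by rewrite -sum1_card natr_sum big_mkcond; apply: eq_bigr => v _; case: (v \in I).
apply: ler_sum => v _; case: (boolP (v \in I)) => vI; last by rewrite !mul0r.
rewrite !mul1r lerBlDr addNr /nbr_sum big1 // => u uv.
case: (boolP (u \in I)) => uI; last by rewrite mulr0.
have := Iind v u vI uI; rewrite /e eq_sym uv /= -leNgt => W0.
by apply/eqP; rewrite mulr1 eq_le W0 weight_ge0.
Qed.

End UpperBounds.

(** * The upper bounds in terms of [OPT_IR] *)

Section PowerBounds.
Variables (R : realType) (V : finType) (W : V -> V -> R).
Hypothesis wW : is_weight W.
Local Notation n := (#|V|%:R).

(** Since the infimum is at least 1, a point within 1 of it is optimal up to a factor 2, which
    avoids proving attainment. *)
Lemma near_optimal : 0 < n :> R ->
  0 < OPT_IR W /\ exists th : V -> R,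
    [/\ forall v, 0 <= th v <= 1, feasible W th,
        0 < \sum_v th v & \sum_v th v <= 2%:R * OPT_IR W].
Proof.
move=> n0; pose S : classical_sets.set R := fun x => exists th : V -> R,
  (forall v, 0 <= th v <= 1) /\ feasible W th /\ x = \sum_(v : V) th v.
have SE : OPT_IR W = inf S by [].
have S1 x : S x -> 1 <= x.
  move=> [th [th01 [thF ->]]].
  have /card_gt0P[v _] : (0 < #|V|)%N by rewrite -(ltr0n R).
  have [th0 /(_ v) h] := thF; apply: le_trans h _.
  apply: ler_sum => u _; rewrite -[leRHS]mul1r; apply: ler_wpM2r => //.
  exact: weight_le1.
have Sn : S n.
  exists (fun=> 1); split; first by move=> v; rewrite lexx ler01.
  split; last by rewrite sum_cst mulr1.
  split=> // u; rewrite row_sumE // lerDl; exact: nbr_sum_ge0.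
have infS : has_inf S.
  by split; [exists n | exists 1 => x /S1].
have opt1 : 1 <= OPT_IR W.
  by rewrite SE; apply: lb_le_inf; [exists n | move=> x /S1].
split; first by lra.
have [x [th [th01 [thF xE]]] xlt] := inf_adherent ltr01 infS.
exists th; split=> //; first by apply: lt_le_trans (S1 _ _) => //; exists th.
by rewrite -xE; move: xlt; rewrite -SE; lra.
Qed.

Lemma empty_scheme : n = 0 :> R ->
  exists (sig : 'I_3 -> R) (phi : profile V -> {ffun V -> 'I_3} -> R),
    [/\ is_scheme sig phi, persuasive W sig phi & cost sig phi = 0].
Proof.
move=> /eqP; rewrite pnatr_eq0 => /eqP n0.
have noV (v : V) : False.
  by have := max_card (pred1 v); rewrite n0 card1.
(* The values 0, 1/2, 1 only have to be distinct; the empty signal vector is the only one. *)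
exists (fun j => j%:R / 2%:R), (fun _ _ => #|{ffun V -> 'I_3}|%:R^-1).
have card1 : #|{ffun V -> 'I_3}|%:R = 1 :> R.
  by rewrite card_ffun n0 expn0.
split.
- split; last split.
  + move=> i j /eqP; rewrite (inj_eq (mulIf _)) ?invr_eq0 ?pnatr_eq0 //.
    by rewrite eqr_nat => /eqP/val_inj.
  + move=> j; rewrite divr_ge0 ?ler0n //= ler_pdivrMr ?ltr0n // mul1r ler_nat.
    by rewrite -ltnS ltn_ord.
  + move=> t _; split=> [a|]; first by rewrite invr_ge0.
    by rewrite sumr_const -[_ *+ _]mulr_natl card1 invr1 mulr1.
- by move=> [i Hi]; exfalso; move: Hi; rewrite n0.
- rewrite /cost /Ejoint big1 // => t _; rewrite big1 // => a _.
  by rewrite [X in _ * X]big1 ?mulr0 // => v; case: (noV v).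
Qed.

(** Absorbs the factor 2 of near-optimality, turning 256 into 512 in both bounds. *)
Lemma powR2_le (a : R) (x : R) : 0 <= x -> 0 <= a <= 1 ->
  (2%:R * x) `^ a <= 2%:R * x `^ a.
Proof.
move=> x0 /andP[a0 a1]; rewrite powRM //; apply: ler_wpM2r; first exact: powR_ge0.
by rewrite -[leRHS]powRr1 //; apply: ler_powR => //; rewrite ler1n.
Qed.

Lemma upper_any :
  exists (sig : 'I_3 -> R) (phi : profile V -> {ffun V -> 'I_3} -> R),
    is_scheme sig phi /\ persuasive W sig phi /\
    cost sig phi <= 512%:R * (n `^ (3%:R / 4%:R)) * ((OPT_IR W) `^ (1 / 2%:R)).
Proof.
have [n0|n0] := eqVneq (n : R) 0.
  have [sig [phi [? ? c0]]] := empty_scheme n0.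
  exists sig, phi; do !split=> //; rewrite c0.
  by rewrite !mulr_ge0 ?powR_ge0.
have npos : 0 < n :> R by rewrite lt_neqAle eq_sym n0 /=.
have [opt0 [th [th01 thF k0 kopt]]] := near_optimal npos.
set k := \sum_v th v in k0 kopt.
pose T := n `^ (3%:R / 4%:R) * k `^ (1 / 2%:R).
have T0 : 0 < T by rewrite mulr_gt0 ?powR_gt0.
have TE : T ^+ 4 = n ^+ 3 * k ^+ 2.
  rewrite /T exprMn -!powR_mulrn ?powR_ge0 ?(ltW npos) ?(ltW k0) // -!powRrM.
  by congr (_ `^ _ * _ `^ _); field.
have [sig [phi [sch per cs]]] := scheme_any_weights wW th01 thF npos T0 TE.
exists sig, phi; do !split=> //; apply: le_trans cs _.
have -> : 512%:R = 256%:R * 2%:R :> R by ring.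
rewrite /T -!mulrA; apply: ler_wpM2l => //.
rewrite mulrCA; apply: ler_wpM2l; first exact: powR_ge0.
apply: (@le_trans _ _ ((2%:R * OPT_IR W) `^ (1 / 2%:R))).
  by apply: ge0_ler_powR; rewrite ?nnegrE ?mulr_ge0 ?(ltW k0) ?(ltW opt0) //; lra.
by apply: powR2_le; rewrite ?(ltW opt0) //; lra.
Qed.

Lemma upper_weights_ge (delta : R) : 0 < delta <= 1 ->
  (forall u v, u != v -> 0 < W u v -> delta <= W u v) ->
  exists (sig : 'I_3 -> R) (phi : profile V -> {ffun V -> 'I_3} -> R),
    is_scheme sig phi /\ persuasive W sig phi /\
    cost sig phi <= 512%:R * ((n * OPT_IR W) `^ (2%:R / 3%:R))
                        * (delta `^ (- (1 / 3%:R))).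
Proof.
move=> d01 Wd; have [n0|n0] := eqVneq (n : R) 0.
  have [sig [phi [? ? c0]]] := empty_scheme n0.
  exists sig, phi; do !split=> //; rewrite c0.
  by rewrite !mulr_ge0 ?powR_ge0.
have npos : 0 < n :> R by rewrite lt_neqAle eq_sym n0 /=.
have [opt0 [th [th01 thF k0 kopt]]] := near_optimal npos.
set k := \sum_v th v in k0 kopt.
have d0 : 0 < delta by case/andP: d01.
have nk0 : 0 < n * k by rewrite mulr_gt0.
pose T := (n * k) `^ (2%:R / 3%:R) * delta `^ (- (1 / 3%:R)).
have T0 : 0 < T by rewrite mulr_gt0 ?powR_gt0.
have TE : delta * T ^+ 3 = n ^+ 2 * k ^+ 2.
  rewrite /T -[RHS]exprMn [_ ^+ 3]exprMn -!(powR_mulrn 3) ?powR_ge0 // -!powRrM.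
  have -> : 2%:R / 3%:R * 3%:R = 2%:R :> R by field.
  have -> : - (1 / 3%:R) * 3%:R = -1 :> R by field.
  rewrite powR_mulrn ?(ltW nk0) // powR_inv1 ?(ltW d0) //.
  by rewrite mulrCA mulfV ?mulr1 ?gt_eqF.
have [sig [phi [sch per cs]]] :=
  scheme_weights_ge wW th01 thF npos d01 Wd T0 TE.
exists sig, phi; do !split=> //; apply: le_trans cs _.
rewrite /T mulrA; apply: ler_wpM2r; first exact: powR_ge0.
have -> : 512%:R = 256%:R * 2%:R :> R by ring.
rewrite -mulrA; apply: ler_wpM2l => //.
have nopt : 0 < n * OPT_IR W by rewrite mulr_gt0.
apply: (@le_trans _ _ ((2%:R * (n * OPT_IR W)) `^ (2%:R / 3%:R))).
  apply: ge0_ler_powR; rewrite ?nnegrE ?mulr_ge0 ?(ltW npos) ?(ltW k0) ?(ltW opt0) //; first lra.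
  by rewrite mulrCA ler_wpM2l // ltW.
by apply: powR2_le; rewrite ?(ltW nopt) //; lra.
Qed.

End PowerBounds.

(** * Weak duality for persuasive schemes *)

Section DualBound.
Variables (R : realType) (V : finType) (W : V -> V -> R).

(** A zero probability is a sum of nonnegative terms, so each of them vanishes and the slack
    inherits these zero factors. *)
Lemma signal_slack_eq0 k (sig : 'I_k -> R) (phi : profile V -> _ -> R) i j :
  is_scheme sig phi -> ~~ (0 < PrSig sig phi i (sig j)) ->
  signal_slack W sig phi i j = 0.
Proof.
move=> [_ [_ phiP]] Pr0.
have term_ge0 t a : t \in bijs V ->
    0 <= #|bijs V|%:R^-1 * phi t a * ((sig (a (t i)) == sig j) : nat)%:R.
  by move=> /phiP[phi0 _]; rewrite !mulr_ge0 ?invr_ge0.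
have Pr_ge0 : 0 <= PrSig sig phi i (sig j).
  by apply: sumr_ge0 => t tb; apply: sumr_ge0 => a _; apply: term_ge0.
have {Pr0 Pr_ge0} : PrSig sig phi i (sig j) = 0.
  by apply/eqP; rewrite eq_le Pr_ge0 andbT leNgt.
rewrite /PrSig /Ejoint => /psumr_eq0P Pr0.
rewrite /signal_slack /Ejoint big1 // => t tb; rewrite big1 // => a _.
have /psumr_eq0P Prt : \sum_a #|bijs V|%:R^-1 * phi t a *
    ((sig (a (t i)) == sig j) : nat)%:R = 0.
  by apply: Pr0 => // t' tb'; apply: sumr_ge0 => a' _; apply: term_ge0.
by rewrite mulrA Prt ?mul0r // => a' _; apply: term_ge0.
Qed.

(* Weak duality: [g] collects one multiplier per signal value, of free sign
   except at the value [0], where persuasion is only an inequality. *)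
Lemma persuasive_multipliers k (sig : 'I_k -> R) (phi : profile V -> _ -> R)
    (g : R -> R) :
  is_scheme sig phi -> persuasive W sig phi -> 0 <= g 0 ->
  0 <= Ejoint phi (fun t a => \sum_v g (sig (a v)) * slack W (fun u => sig (a u)) v).
Proof.
move=> sch per g0; have [sigI [sig01 _]] := sch.
have slackP := (persuasive_slack W sch).1 per.
(* Vertices are reindexed by agents through [t], and the multiplier at the received signal is spread
   over all labels. *)
rewrite (@eq_Ejoint _ _ _ _ _ (fun t a => \sum_(i : agent V) \sum_j g (sig j) *
  (((sig (a (t i)) == sig j) : nat)%:R * slack W (fun v => sig (a v)) (t i)))).
  rewrite Ejoint_sum; apply: sumr_ge0 => i _; rewrite Ejoint_sum.
  apply: sumr_ge0 => j _; rewrite EjointZ -/(signal_slack W sig phi i j).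
  case: (boolP (0 < PrSig sig phi i (sig j))) => [/slackP|/(signal_slack_eq0 sch) ->].
    case=> S0 Seq; case/andP: (sig01 j); rewrite le_eqVlt.
    by case/orP => [/eqP <-|/Seq ->] _; rewrite ?mulr0 // mulr_ge0.
  by rewrite mulr0.
move=> t a tb; rewrite (reindex t) /=; last exact: onW_bij (bijs_bij tb).
apply: eq_bigr => i _; rewrite (bigD1 (a (t i))) //= eqxx mul1r big1 ?addr0 //.
by move=> j /negbTE ja; rewrite (inj_eq sigI) eq_sym ja mul0r mulr0.
Qed.

End DualBound.

(** * The dual multiplier, on one clique and on the centers *)

Section Multiplier.
Variables (R : realType) (mr : R).
Hypothesis mr200 : 200%:R <= mr.

(** The affine part alone is too weak at the cheap vectors where both centers send nearly 1; there
    the centers have positive slack, and the jump gives it a multiplier of order [- mr^2]. *)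
Definition multiplier (s : R) : R :=
  1 / 2%:R - mr / 4%:R * s - mr ^+ 2 / 80%:R * (1 - 2%:R / mr <= s)%R%:R.

(* [y] is half the mass of a clique and [xi] half the mass of the two centers. *)
Definition clique_loss (xi y : R) : R := (1 - xi) * (1 - y) ^+ 2 + xi * y ^+ 2.

Let mr_gt0 : 0 < mr. Proof. by apply: lt_le_trans mr200. Qed.

(** [clique_loss xi y] equals [(y - (1 - xi))^2 + xi (1 - xi)]. *)
Lemma clique_loss_ge xi y : xi * (1 - xi) <= clique_loss xi y.
Proof. by have := sqr_ge0 (y - (1 - xi)); rewrite /clique_loss; lra. Qed.

(** The affine part of the multiplier produces [mr / 2] times the loss. The penalties hurt only if
    some [x i] is near 1 while [sg < 1 + eta]; then at most two of them do, each by at most [eta],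
    and half of the loss pays for this. *)
Lemma clique_bound (m : nat) (x : 'I_m -> R) (xi sg : R) : m%:R = mr ->
  0 <= xi <= 1 -> (forall i, 0 <= x i <= 1) -> sg = \sum_i x i ->
  \sum_i multiplier (x i) * (x i / 2%:R + sg / 2%:R + xi - 1) <=
  sg / 4%:R + mr / 4%:R * xi * sg - mr / 4%:R * clique_loss xi (sg / 2%:R).
Proof.
have mr0 := mr_gt0; have m200 := mr200.
move=> mE /andP[xi0 xi1] x01 sgE.
pose eta : R := 2%:R / mr.
have etaM : eta * mr = 2%:R by rewrite /eta divfK ?gt_eqF.
have eta0 : 0 < eta by rewrite divr_gt0.
have eta1 : eta <= 1 / 100%:R by rewrite ler_pdivrMr //; lra.
pose h i : R := (1 - eta <= x i)%R%:R.
have x_le i : x i <= sg.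
  rewrite sgE (bigD1 i) //= lerDl; apply: sumr_ge0 => j _.
  by case/andP: (x01 j).
pose Hs := \sum_i h i * (1 - x i / 2%:R - sg / 2%:R - xi).
have Q0 : 0 <= clique_loss xi (sg / 2%:R).
  by rewrite addr_ge0 // mulr_ge0 ?sqr_ge0 ?subr_ge0.
have HsQ : Hs <= 10%:R * eta * clique_loss xi (sg / 2%:R).
  have rhs0 : 0 <= 10%:R * eta * clique_loss xi (sg / 2%:R).
    by apply: mulr_ge0 => //; apply: mulr_ge0 => //; apply: ltW.
  have [sg_big|sg_small] := lerP (1 + eta) sg.
    apply: le_trans rhs0; apply: sumr_le0 => i _; rewrite /h.
    case: (lerP (1 - eta) (x i)) => xi_big; last by rewrite mul0r.
    by rewrite mul1r; lra.
  case: (boolP [exists i, 1 - eta <= x i]) => [/existsP[i0 Hi0]|]; last first.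
    rewrite negb_exists => /forallP noh; apply: le_trans rhs0.
    by apply: sumr_le0 => i _; rewrite /h (negbTE (noh i)) mul0r.
  have sg_low : 1 - eta <= sg := le_trans Hi0 (x_le i0).
  have cnt : \sum_i h i <= 2%:R.
    have : (1 - eta) * \sum_i h i <= sg.
      rewrite mulr_sumr sgE; apply: ler_sum => i _; rewrite /h.
      case: (lerP (1 - eta) (x i)) => xi_big; first by rewrite mulr1.
      by rewrite mulr0; case/andP: (x01 i).
    have : 0 <= \sum_i h i by apply: sumr_ge0 => i _; apply: ler0n.
    move: (\sum_i h i) => c c0; have := ler_wpM2r c0 eta1; lra.
  apply: (@le_trans _ _ (\sum_i h i * eta)).
    apply: ler_sum => i _; rewrite /h.
    case: (lerP (1 - eta) (x i)) => xi_big; last by rewrite !mul0r.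
    by rewrite !mul1r; lra.
  rewrite -mulr_suml [leRHS]mulrAC; apply: ler_wpM2r; first exact: ltW.
  apply: le_trans cnt _.
  (* Here [sg / 2] is within 1/20 of 1/2, so the loss is at least [(45/100)^2 > 1/5], as the factor
     10 demands. *)
  have ylow : (45%:R / 100%:R) ^+ 2 <= (sg / 2%:R) ^+ 2.
    by rewrite ler_pXn2r ?nnegrE //; lra.
  have yhigh : (45%:R / 100%:R) ^+ 2 <= (1 - sg / 2%:R) ^+ 2.
    by rewrite ler_pXn2r ?nnegrE //; lra.
  have xi1' : 0 <= 1 - xi by lra.
  have := ler_wpM2l xi0 ylow; have := ler_wpM2l xi1' yhigh.
  by rewrite /clique_loss; lra.
have -> : \sum_i multiplier (x i) * (x i / 2%:R + sg / 2%:R + xi - 1) =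
   sg / 4%:R + mr / 4%:R * xi * sg - mr / 2%:R * clique_loss xi (sg / 2%:R)
   - mr / 8%:R * (\sum_i x i ^+ 2) + mr ^+ 2 / 80%:R * Hs.
  have -> : \sum_i multiplier (x i) * (x i / 2%:R + sg / 2%:R + xi - 1) =
     \sum_i ((1 / 4%:R - mr / 4%:R * (sg / 2%:R + xi - 1)) * x i
       + 1 / 2%:R * (sg / 2%:R + xi - 1) + (- (mr / 8%:R)) * x i ^+ 2
       + mr ^+ 2 / 80%:R * (h i * (1 - x i / 2%:R - sg / 2%:R - xi))).
    by apply: eq_bigr => i _; rewrite /multiplier -/eta /h; field.
  rewrite !big_split /= -!mulr_sumr -sgE -/Hs sumr_const card_ord -[_ *+ m]mulr_natr mE.
  by rewrite /clique_loss; field.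
have q0 : 0 <= mr / 8%:R * (\sum_i x i ^+ 2).
  apply: mulr_ge0; first by rewrite divr_ge0 // ltW.
  by apply: sumr_ge0 => i _; apply: sqr_ge0.
have c0 : 0 <= mr ^+ 2 / 80%:R by rewrite divr_ge0 // exprn_ge0 // ltW.
have := ler_wpM2l c0 HsQ.
have -> : mr ^+ 2 / 80%:R * (10%:R * eta * clique_loss xi (sg / 2%:R)) =
    (eta * mr) * (mr / 8%:R * clique_loss xi (sg / 2%:R)) by field.
by rewrite etaM; lra.
Qed.

(** For [xi] near 1 the penalty yields at least [mr^2 / 160]; near 0, either the leaves have mass
    [mr^2 / 2] or [Q >= mr^2 / 4]; in between, [Qmid] gives [Q >= mr / 2], which enters with factor
    [mr / 4]. *)
Lemma centers_bound (z0 z1 xi sg Q : R) :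
  0 <= z0 <= 1 -> 0 <= z1 <= 1 -> 0 <= sg -> xi = (z0 + z1) / 2%:R ->
  mr ^+ 2 * (xi * (1 - xi)) <= Q -> (1 - xi) * (mr ^+ 2 - sg) <= Q -> 0 <= Q ->
  mr ^+ 2 / 200%:R + 
  (sg / 4%:R + mr / 4%:R * xi * sg - mr / 4%:R * Q) +
  (multiplier z0 * (z0 / 2%:R + sg / 2%:R + xi - 1) +
   multiplier z1 * (z1 / 2%:R + sg / 2%:R + xi - 1)) <= sg + z0 + z1.
Proof.
have mr0 := mr_gt0; have m200 := mr200.
move=> /andP[z00 z01] /andP[z10 z11] sg0 xiE Qmid Qlow Q0.
pose eta : R := 2%:R / mr.
have etaM : eta * mr = 2%:R by rewrite /eta divfK ?gt_eqF.
have eta0 : 0 < eta by rewrite divr_gt0.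
have eta1 : eta <= 1 / 100%:R by rewrite ler_pdivrMr //; lra.
have xi0 : 0 <= xi by lra.
have xi1 : xi <= 1 by lra.
pose G := mr ^+ 2 / 80%:R.
pose h (z : R) : R := (1 - eta <= z)%R%:R.
pose Hc := h z0 * (1 - z0 / 2%:R - sg / 2%:R - xi) +
           h z1 * (1 - z1 / 2%:R - sg / 2%:R - xi).
have totE : multiplier z0 * (z0 / 2%:R + sg / 2%:R + xi - 1) +
   multiplier z1 * (z1 / 2%:R + sg / 2%:R + xi - 1) =
   3%:R / 2%:R * xi + sg / 2%:R - 1
   - mr / 4%:R * ((z0 ^+ 2 + z1 ^+ 2) / 2%:R + xi * sg) 
   + mr / 2%:R * (xi * (1 - xi)) + G * Hc.
  by rewrite /multiplier -/eta /Hc /h /G xiE; field.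
have q0 : 0 <= mr / 8%:R * (z0 ^+ 2 + z1 ^+ 2).
  by apply: mulr_ge0; rewrite ?addr_ge0 ?sqr_ge0 // divr_ge0 // ltW.
have xi4 : mr / 2%:R * (xi * (1 - xi)) <= mr / 8%:R.
  have -> : mr / 8%:R = mr / 2%:R * (1 / 4%:R) by field.
  apply: ler_wpM2l; first by rewrite divr_ge0 // ltW.
  by have := sqr_ge0 (xi - 1 / 2%:R); lra.
have G0 : 0 <= G by rewrite divr_ge0 // exprn_ge0 // ltW.
have mm : 200%:R * mr <= mr ^+ 2 by rewrite expr2; apply: ler_wpM2r => //; apply: ltW.
(* The terms [mr / 4 * xi * sg] of leaves and centers cancel, since both use the same slope. *)
suff key : mr ^+ 2 / 200%:R + 1 / 2%:R + mr / 8%:R + G * Hc <=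
    sg / 4%:R + mr / 4%:R * Q.
  by rewrite totE; lra.
have h01 z : 0 <= h z <= 1 by rewrite /h; case: (_ <= z); rewrite ?lexx ?ler01.
have Hc_le : Hc <= 2%:R * eta.
  have Hz (z : R) : z / 2%:R <= xi -> h z * (1 - z / 2%:R - sg / 2%:R - xi) <= eta.
    move=> zxi; rewrite /h; case: (lerP (1 - eta) z) => hz.
      by rewrite mul1r; lra.
    by rewrite mul0r ltW.
  by have := Hz z0; have := Hz z1; rewrite /Hc; lra.
have GHc : G * Hc <= mr / 20%:R.
  apply: le_trans (ler_wpM2l G0 Hc_le) _.
  have -> : G * (2%:R * eta) = (eta * mr) * (mr / 40%:R) by rewrite /G; field.
  by rewrite etaM; lra.
have mQ0 : 0 <= mr / 4%:R * Q by rewrite mulr_ge0 // divr_ge0 // ltW.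
have [xi_high|xi_lt] := lerP (1 - eta / 2%:R) xi.
  have Hc' : Hc <= - (1 / 2%:R).
    have -> : Hc = (1 - z0 / 2%:R - sg / 2%:R - xi) + (1 - z1 / 2%:R - sg / 2%:R - xi).
      rewrite /Hc /h.
      have -> : 1 - eta <= z0 by lra.
      have -> : 1 - eta <= z1 by lra.
      by rewrite !mul1r.
    by lra.
  by have := ler_wpM2l G0 Hc'; rewrite /G in G0 *; lra.
have [xi_low|xi_gt] := lerP xi (eta / 2%:R).
  have [sg_big|sg_small] := lerP (mr ^+ 2 / 2%:R) sg; first by lra.
  have Qm : mr ^+ 2 / 4%:R <= Q.
    apply: le_trans Qlow.
    have m20 : 0 <= mr ^+ 2 by rewrite exprn_ge0 // ltW.
    have := ler_pM (_ : 0 <= 1 / 2%:R) (_ : 0 <= mr ^+ 2 / 2%:R)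
      (_ : 1 / 2%:R <= 1 - xi) (_ : mr ^+ 2 / 2%:R <= mr ^+ 2 - sg).
      have -> : 1 / 2%:R * (mr ^+ 2 / 2%:R) = mr ^+ 2 / 4%:R by field.
    by apply; lra.
  have : 1 * (mr ^+ 2 / 4%:R) <= mr / 4%:R * Q.
    by apply: ler_pM => //; [apply: divr_ge0 => //; rewrite exprn_ge0 // ltW | lra].
  by lra.
have Qm : mr / 2%:R <= Q.
  apply: le_trans Qmid.
  have : eta / 2%:R * (1 / 2%:R) <= xi * (1 - xi).
    have [x1|x1] := lerP xi (1 / 2%:R).
      by apply: ler_pM; lra.
    by rewrite [leRHS]mulrC; apply: ler_pM; lra.
  move/(ler_wpM2l (ltW (exprn_gt0 2 mr0))); apply: le_trans.
  have -> : mr ^+ 2 * (eta / 2%:R * (1 / 2%:R)) = (eta * mr) * (mr / 4%:R) by field.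
  by rewrite etaM; lra.
have : mr / 4%:R * (mr / 2%:R) <= mr / 4%:R * Q.
  by apply: ler_wpM2l => //; rewrite divr_ge0 // ltW.
have -> : mr / 4%:R * (mr / 2%:R) = mr ^+ 2 / 8%:R by field.
lra.
Qed.

End Multiplier.

(** * The clique graph and its lower bound *)

Section CliqueGraph.
Variables (R : realType) (m : nat).
Hypothesis m200 : (200 <= m)%N.
Local Notation mr := (m%:R : R).
Local Notation T := (('I_m * 'I_m) * 'I_m + bool)%type.

(** In [inl (c, i)] the pair [c] names the clique and [i] the member; [inr] gives the two
    centers. *)
Definition clique_adj (x y : T) : bool :=
  match x, y with inl p, inl q => p.1 == q.1 | _, _ => true end.

Definition clique_weight (x y : T) : R :=
  if x == y then 1 else if clique_adj x y then 1 / 2%:R else 0.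

Lemma clique_adj_sym x y : clique_adj x y = clique_adj y x.
Proof. by case: x y => [p|b] [q|c] //=; rewrite eq_sym. Qed.

Lemma clique_adj_refl x : clique_adj x x.
Proof. by case: x => [p|b] /=; rewrite ?eqxx. Qed.

Lemma clique_weight_sym x y : clique_weight x y = clique_weight y x.
Proof. by rewrite /clique_weight eq_sym clique_adj_sym. Qed.

Lemma clique_weight01 x y : 0 <= clique_weight x y <= 1.
Proof. by rewrite /clique_weight; do 2?case: ifP => _; lra. Qed.

Lemma clique_weight_diag x : clique_weight x x = 1.
Proof. by rewrite /clique_weight eqxx. Qed.

(** Half of the unit self-weight joins the edges, so the sum covers a closed neighbourhood with the
    single weight 1/2. *)
Lemma clique_slack (s : T -> R) x :
  slack clique_weight s x =
  s x / 2%:R + (\sum_(y | clique_adj x y) s y) / 2%:R - 1.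
Proof.
rewrite /slack /nbr_sum (bigD1 x (clique_adj_refl x)) /=.
rewrite mulrDl addrA -[s x in LHS](mulr1 (s x)).
have -> : s x * 1 = s x / 2%:R + s x / 2%:R by field.
congr (_ + _ - 1); rewrite mulr_suml big_mkcond [RHS]big_mkcond.
apply: eq_bigr => y _; rewrite /clique_weight [x == y]eq_sym.
by case: (y == x); case: (clique_adj x y) => //=; field.
Qed.

Lemma sum_vertices (f : T -> R) :
  \sum_x f x = (\sum_c \sum_i f (inl (c, i))) + (f (inr true) + f (inr false)).
Proof.
rewrite big_sumType big_bool /=; congr (_ + _).
by rewrite pair_bigA; apply: eq_bigr => -[c i] _.
Qed.

(** The dual inequality holds for each signal vector separately, hence in expectation under any
    scheme. Cliques are bounded one by one and their losses added up in [Q]. *)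
Lemma pointwise_bound (s : T -> R) : (forall x, 0 <= s x <= 1) ->
  mr ^+ 2 / 200%:R + \sum_x multiplier mr (s x) * slack clique_weight s x
  <= \sum_x s x.
Proof.
move=> s01; have mr200 : 200%:R <= mr by rewrite ler_nat.
pose sc c := \sum_i s (inl (c, i)).
pose sg := \sum_c sc c.
set z0 := s (inr true); set z1 := s (inr false).
pose xi := (z0 + z1) / 2%:R.
have xi01 : 0 <= xi <= 1.
  by have := s01 (inr true); have := s01 (inr false); rewrite -/z0 -/z1 /xi; lra.
have leafE c i : slack clique_weight s (inl (c, i)) =
    s (inl (c, i)) / 2%:R + sc c / 2%:R + xi - 1.
  rewrite clique_slack big_mkcond sum_vertices /= (bigD1 c) //= eqxx.
  rewrite [X in (_ + X + _) / _]big1 ?addr0 => [|d dc]; last first.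
    by rewrite big1 // => j _; rewrite eq_sym (negbTE dc).
  by rewrite -/z0 -/z1 -/(sc c) /xi; field.
have centerE b : slack clique_weight s (inr b) =
    s (inr b) / 2%:R + sg / 2%:R + xi - 1.
  by rewrite clique_slack sum_vertices -/z0 -/z1 -/sg /xi; field.
have sc_ge0 c : 0 <= sc c by apply: sumr_ge0 => i _; case/andP: (s01 (inl (c, i))).
pose Q := \sum_c clique_loss xi (sc c / 2%:R).
have sumM (a : R) : \sum_(c : 'I_m * 'I_m) a = mr ^+ 2 * a.
  by rewrite sumr_const card_prod !card_ord -[LHS]mulr_natl natrM -expr2.
have leaves : \sum_c \sum_i multiplier mr (s (inl (c, i))) *
      slack clique_weight s (inl (c, i)) <=
    sg / 4%:R + mr / 4%:R * xi * sg - mr / 4%:R * Q.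
  rewrite /sg /Q mulr_suml !mulr_sumr -big_split -sumrB; apply: ler_sum => c _ /=.
  under eq_bigr => i _ do rewrite leafE.
  by apply: clique_bound.
rewrite !sum_vertices !centerE -/z0 -/z1 -/sg addrA [leRHS]addrA.
have := @centers_bound R mr mr200 z0 z1 xi sg Q (s01 _) (s01 _).
move=> H; apply: le_trans (H _ _ _ _ _) => //.
- by rewrite lerD2r lerD2l.
- exact: sumr_ge0.
- rewrite -sumM; apply: ler_sum => c _; exact: clique_loss_ge.
- have -> : mr ^+ 2 - sg = \sum_c (1 - sc c) by rewrite sumrB sumM mulr1.
  rewrite mulr_sumr; apply: ler_sum => c _.
  (* [(1 - sc / 2)^2 >= 1 - sc], and the other summand of the loss is nonnegative. *)
  case/andP: xi01 => xi0 xi1; apply: (@le_trans _ _ ((1 - xi) * (1 - sc c / 2%:R) ^+ 2)).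
    apply: ler_wpM2l; first by rewrite subr_ge0.
    by have := sqr_ge0 (sc c); clear; lra.
  by rewrite lerDl mulr_ge0 ?sqr_ge0.
- apply: sumr_ge0 => c _; case/andP: xi01 => xi0 xi1.
  by rewrite addr_ge0 // mulr_ge0 ?sqr_ge0 ?subr_ge0.
Qed.

Local Notation n := #|{: T}|.

Definition clique_graph (u v : 'I_n) : R := clique_weight (enum_val u) (enum_val v).

Lemma card_vertices : n = (m ^ 3 + 2)%N.
Proof. by rewrite card_sum card_bool !card_prod !card_ord !expnS expn0 muln1 mulnA. Qed.

Lemma clique_graph_weight : is_weight clique_graph.
Proof.
split; first by move=> u v; apply: clique_weight_sym.
by split=> [u v|v]; [apply: clique_weight01 | apply: clique_weight_diag].
Qed.

Lemma clique_graph_half u v : u != v ->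
  clique_graph u v = 0 \/ clique_graph u v = 1 / 2%:R.
Proof.
move=> uv; rewrite /clique_graph /clique_weight (inj_eq enum_val_inj) (negbTE uv).
by case: clique_adj; [right | left].
Qed.

Lemma sum_enum_val (f : T -> R) : \sum_(u : 'I_n) f (enum_val u) = \sum_x f x.
Proof.
rewrite [RHS](reindex (@enum_val _ {: T})) //=.
by exists enum_rank => x _; [apply: enum_valK | apply: enum_rankK].
Qed.

Lemma clique_graph_slack (s : 'I_n -> R) u :
  slack clique_graph s u = slack clique_weight (fun x => s (enum_rank x)) (enum_val u).
Proof.
rewrite /slack enum_valK; congr (_ + _ - 1).
rewrite /nbr_sum big_mkcond [RHS]big_mkcond -sum_enum_val; apply: eq_bigr => v _.
by rewrite (inj_eq enum_val_inj) enum_valK.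
Qed.

Lemma clique_graph_bound (s : 'I_n -> R) : (forall u, 0 <= s u <= 1) ->
  mr ^+ 2 / 200%:R + \sum_u multiplier mr (s u) * slack clique_graph s u <= \sum_u s u.
Proof.
move=> s01; have := @pointwise_bound (fun x => s (enum_rank x)) (fun x => s01 _).
rewrite -!sum_enum_val.
under eq_bigr => u _ do rewrite enum_valK -clique_graph_slack.
by under [X in _ <= X -> _]eq_bigr => u _ do rewrite enum_valK.
Qed.

(** Both centers send 1: a leaf sees 1/2 + 1/2 and a center 1 + 1/2. *)
Lemma clique_graph_OPT : OPT_IR clique_graph <= 2%:R.
Proof.
pose s (x : T) : R := if x is inr _ then 1 else 0.
pose th (u : 'I_n) := s (enum_val u).
have s01 x : 0 <= s x <= 1 by case: x => [?|?]; rewrite /= lexx ler01.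
have thE : \sum_u th u = 2%:R.
  by rewrite sum_enum_val sum_vertices /= big1 ?add0r // => c _; rewrite big1.
apply: ge_inf.
  by exists 0 => _ [th' [th'01 [_ ->]]]; apply: sumr_ge0 => v _; case/andP: (th'01 v).
exists th; split; first by move=> v; apply: s01.
split; last by rewrite thE.
split=> [v|u]; first by case/andP: (s01 (enum_val v)).
rewrite (row_sumE clique_graph_weight) -subr_ge0.
have -> : th u + nbr_sum clique_graph th u - 1 =
    slack clique_weight (fun x => th (enum_rank x)) (enum_val u).
  exact: clique_graph_slack.
rewrite clique_slack; have sE x : th (enum_rank x) = s x by rewrite /th enum_rankK.
have -> : \sum_(y | clique_adj (enum_val u) y) th (enum_rank y) = 2%:R.
  rewrite big_mkcond sum_vertices big1 => [|c _]; last first.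
    by rewrite big1 // => i _; rewrite sE; case: ifP.
  by rewrite !sE; case: (enum_val u) => ?; rewrite /= add0r.
by rewrite sE; have := s01 (enum_val u); lra.
Qed.

(** In the average of the pointwise bound, persuasiveness makes the multiplier term nonnegative. *)
Lemma clique_graph_cost k (sig : 'I_k -> R)
    (phi : profile 'I_n -> {ffun 'I_n -> 'I_k} -> R) :
  is_scheme sig phi -> persuasive clique_graph sig phi ->
  mr ^+ 2 / 200%:R <= cost sig phi.
Proof.
move=> sch per; have mr200 : 200%:R <= mr by rewrite ler_nat.
have mr0 : 0 < mr by lra.
have g0 : 0 <= multiplier mr 0.
  (* The penalty is off at 0, because its threshold [1 - 2 / mr] is positive. *)
  have eta1 : 2%:R / mr < 1 by rewrite ltr_pdivrMr // mul1r; lra.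
  have -> : multiplier mr 0 = 1 / 2%:R; last by rewrite divr_ge0.
  rewrite /multiplier; have -> : (1 - 2%:R / mr <= 0) = false by lra.
  by rewrite !mulr0 !subr0.
have := persuasive_multipliers sch per g0.
set D := Ejoint _ _ => D0.
rewrite -(Ejoint_cst (mr ^+ 2 / 200%:R) sch).
apply: (@le_trans _ _ (Ejoint phi (fun _ _ => mr ^+ 2 / 200%:R) + D)).
  by rewrite lerDl.
rewrite -EjointD; apply: (ler_Ejoint sch) => t a _.
by apply: clique_graph_bound => u; have [_ [sig01 _]] := sch.
Qed.

(** From [n = m^3 + 2 <= (2 m)^3] one gets [n^(2/3) <= 4 m^2], whence the constant 800 as 4 times
    200. *)
Lemma clique_graph_card : (1 / 800%:R) * (n%:R `^ (2%:R / 3%:R)) <= mr ^+ 2 / 200%:R.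
Proof.
have mr200 : 200%:R <= mr by rewrite ler_nat.
have mr0 : 0 <= mr by lra.
have m2 : 0 <= 2%:R * mr by lra.
have : n%:R `^ (2%:R / 3%:R) <= ((2%:R * mr) ^+ 3) `^ (2%:R / 3%:R).
  apply: ge0_ler_powR; rewrite ?nnegrE ?exprn_ge0 //; first lra.
  rewrite card_vertices natrD natrX exprMn.
  have : 1 <= mr ^+ 3 by rewrite exprn_ege1 //; lra.
  lra.
have -> : ((2%:R * mr) ^+ 3) `^ (2%:R / 3%:R) = (2%:R * mr) ^+ 2.
  by rewrite -!powR_mulrn // -powRrM; congr (_ `^ _); field.
have -> : (2%:R * mr) ^+ 2 = 4%:R * mr ^+ 2 by ring.
lra.
Qed.

End CliqueGraph.

Theorem theorem1p2 (R : realType) :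
  (exists C : R, 0 < C /\
    (forall (V : finType) (W : V -> V -> R), is_weight W ->
       exists (sig : 'I_3 -> R) (phi : profile V -> {ffun V -> 'I_3} -> R),
         is_scheme sig phi /\ persuasive W sig phi /\
         cost sig phi <= C * ((#|V|%:R) `^ (3%:R / 4%:R))
                           * ((OPT_IR W) `^ (1 / 2%:R))) /\
    (forall delta : R, 0 < delta <= 1 ->
     forall (V : finType) (W : V -> V -> R), is_weight W ->
       (forall u v, u != v -> 0 < W u v -> delta <= W u v) ->
       exists (sig : 'I_3 -> R) (phi : profile V -> {ffun V -> 'I_3} -> R),
         is_scheme sig phi /\ persuasive W sig phi /\
         cost sig phi <= C * ((#|V|%:R * OPT_IR W) `^ (2%:R / 3%:R))
                           * (delta `^ (- (1 / 3%:R))))) /\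
  (exists c : R, 0 < c /\ exists K : R,
     forall N : nat, exists n : nat, (N <= n)%N /\
       exists W : 'I_n -> 'I_n -> R,
         is_weight W /\
         (forall u v, u != v -> W u v = 0 \/ W u v = 1 / 2%:R) /\
         OPT_IR W <= K /\
         forall (k : nat) (sig : 'I_k -> R)
                (phi : profile 'I_n -> {ffun 'I_n -> 'I_k} -> R),
           is_scheme sig phi -> persuasive W sig phi ->
           c * ((n%:R) `^ (2%:R / 3%:R)) <= cost sig phi).
Proof.
split.
  exists 512%:R; split; first by rewrite ltr0n.
  split; first by move=> V W wW; apply: upper_any.
  by move=> delta d01 V W wW Wd; apply: upper_weights_ge.
exists (1 / 800%:R); split; first by rewrite divr_gt0.
exists 2%:R => N; pose m := (N + 200)%N.
have m200 : (200 <= m)%N by rewrite leq_addl.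
exists #|{: ('I_m * 'I_m) * 'I_m + bool}|; split.
  rewrite card_vertices; apply: (@leq_trans m); first exact: leq_addr.
  apply: leq_trans (leq_addr _ _); rewrite -[leqLHS]expn1.
  by rewrite leq_exp2l //; apply: leq_trans m200.
exists (@clique_graph R m); split; first exact: clique_graph_weight.
split; first exact: clique_graph_half.
split; first exact: clique_graph_OPT.
move=> k sig phi sch per.
exact: le_trans (clique_graph_card R m200) (clique_graph_cost m200 sch per).
Qed.
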